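(* Let $K\subset\mathbb{R}^N$ be a $C^2_+$-regular convex body that is symmetric with respect to the origin, and let $\Omega\subset\mathbb{R}^N$ be a convex body. Then $$\lambda_1^K(\Omega)\ \ge\ \frac{\pi^2}{4}\,(R_\Omega^K)^{-2}.$$
   Context: A convex body is a compact convex subset of $\mathbb{R}^N$ with nonempty interior. A convex body $K$ is $C^2_+$-regular if its boundary can be written locally as the graph of a $C^2$ function with positive definite Hessian. The support function of $K$ is $h_K(x)=\max\{x\cdot y : y\in K\}$; when $K$ is symmetric with respect to the origin, $h_K$ is a norm. The $K$-principal frequency of $\Omega$ is $$\lambda_1^K(\Omega)=\min_{u\in W_0^{1,2}(\Omega)\setminus\{0\}}\frac{\int_\Omega h_K^2(\nabla u)\,dx}{\int_\Omega u^2\,dx},$$ where, for a convex body $\Omega$, $W_0^{1,2}(\Omega)$ is the Sobolev space $W^{1,2}_0$ of the interior of $\Omega$. The anisotropic inradius $R_\Omega^K$ is the largest $t$ such that $x+tK\subseteq\Omega$ for some $x\in\Omega$. *)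

(* Defs.v *)
From HB Require Import structures.
From mathcomp Require Import all_boot all_order all_algebra.
From mathcomp Require Import all_classical all_reals all_analysis.

Set Implicit Arguments.
Unset Strict Implicit.
Unset Printing Implicit Defensive.

Import Order.TTheory GRing.Theory Num.Theory.
Import numFieldNormedType.Exports.

Local Open Scope classical_set_scope.
Local Open Scope ring_scope.

(** Points of R^n are row vectors ['rV[R]_n].  The library has no Lebesgue
    measure there, so it is built as the n-fold product of [lebesgue_measure].
    The sigma-algebra is the one generated by the coordinates, as the library
    does for [n.-tuple T]; over R it is the Borel sigma-algebra. *)

Section rV_measurable.
Context {d : measure_display} {T : sigmaRingType d} (n : nat).

Let coors : 'I_n -> 'rV[T]_n -> T := fun i x => x ord0 i.

Let rV_set0 : g_sigma_preimage coors set0.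
Proof. exact: sigma_algebra0. Qed.

Let rV_setC A : g_sigma_preimage coors A -> g_sigma_preimage coors (~` A).
Proof. exact: sigma_algebraC. Qed.

Let rV_bigcup (F : (set 'rV[T]_n)^nat) :
  (forall i, g_sigma_preimage coors (F i)) ->
  g_sigma_preimage coors (\bigcup_i (F i)).
Proof. exact: sigma_algebra_bigcup. Qed.

HB.instance Definition _ := @isMeasurable.Build (measure_tuple_display d)
  'rV[T]_n (g_sigma_preimage coors) rV_set0 rV_setC rV_bigcup.

Lemma measurable_coord (i : 'I_n) :
  measurable_fun [set: 'rV[T]_n] (fun x : 'rV[T]_n => x ord0 i).
Proof.
move=> _ Y mY; rewrite setTI; apply: sub_sigma_algebra => /=.
rewrite -bigcup_seq/=; exists i => /=; first by rewrite mem_index_enum.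
by exists Y => //; rewrite setTI.
Qed.

End rV_measurable.

Lemma measurable_fun_rowP d1 d2 (T1 : measurableType d1)
    (T2 : measurableType d2) n (f : T1 -> 'rV[T2]_n) :
  (forall i, measurable_fun [set: T1] (fun x => f x ord0 i)) ->
  measurable_fun [set: T1] f.
Proof.
move=> mf; pose g i : T1 -> T2 := (fun x : 'rV[T2]_n => x ord0 i) \o f.
suff H : g_sigma_preimage g `<=` measurable.
  move=> _ A mA; apply: H.
  by rewrite /g g_sigma_preimage_comp; exists A.
apply: smallest_sub; first exact: sigma_algebra_measurable.
move=> A; rewrite -bigcup_seq => -[i _ [B mB <-]].
exact: mf.
Qed.

Section lebesgue_measure_rV.
Context (R : realType).

Definition rV_cons n (p : measurableTypeR R * 'rV[R]_n) : 'rV[R]_n.+1 :=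
  row_mx (const_mx (p.1 : R) : 'rV[R]_1) p.2.

Definition rV_uncons n (x : 'rV[R]_n.+1) : measurableTypeR R * 'rV[R]_n :=
  (x ord0 ord0, rsubmx (x : 'rV[R]_(1 + n))).

Lemma rV_consK n : cancel (@rV_cons n) (@rV_uncons n).
Proof.
move=> [t y]; rewrite /rV_uncons /rV_cons; congr pair; last exact: row_mxKr.
rewrite (_ : ord0 = lshift n (ord0 : 'I_1)); last exact: val_inj.
by rewrite [LHS]row_mxEl mxE.
Qed.

Lemma rV_unconsK n : cancel (@rV_uncons n) (@rV_cons n).
Proof.
move=> x; rewrite /rV_uncons /rV_cons/=.
rewrite (_ : const_mx _ = lsubmx (x : 'rV[R]_(1 + n))).
  exact: (hsubmxK (x : 'rV[R]_(1 + n))).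
by apply/rowP => i; rewrite !mxE !ord1; congr (x _ _); exact: val_inj.
Qed.

Lemma measurable_rV_cons n : measurable_fun setT (@rV_cons n).
Proof.
apply: measurable_fun_rowP => i.
case: (split_ordP (i : 'I_(1 + n))) => j ->.
  rewrite (_ : (fun _ => _) = fst); first exact: measurable_fst.
  by apply/funext => p; rewrite [LHS]row_mxEl mxE.
rewrite (_ : (fun _ => _) = (fun y : 'rV[R]_n => y ord0 j) \o snd).
  exact: (measurableT_comp (measurable_coord j) measurable_snd).
by apply/funext => p; rewrite [LHS]row_mxEr.
Qed.

Lemma measurable_rV_uncons n : measurable_fun setT (@rV_uncons n).
Proof.
apply/measurable_fun_pairP; split; first exact: measurable_coord.
apply: measurable_fun_rowP => i.
rewrite (_ : (fun _ => _) = (fun x : 'rV[R]_n.+1 => x ord0 (rshift 1 i))).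
  exact: measurable_coord.
by apply/funext => x; rewrite /= mxE.
Qed.

Section step.
Context n (m : {sigma_finite_measure set 'rV[R]_n -> \bar R}).

Definition lebesgue_step : set 'rV[R]_n.+1 -> \bar R :=
  pushforward (@lebesgue_measure R \x m)%E (@rV_cons n).

Let step0 : lebesgue_step set0 = 0%E.
Proof. by rewrite /lebesgue_step /pushforward preimage_set0 measure0. Qed.

Let step_ge0 A : (0 <= lebesgue_step A)%E.
Proof. exact: (measure_ge0 (@lebesgue_measure R \x m)%E). Qed.

Let step_sigma_additive : semi_sigma_additive lebesgue_step.
Proof.
move=> F mF tF mUF; rewrite /lebesgue_step /pushforward preimage_bigcup.
apply: (@measure_semi_sigma_additive _ _ _ (@lebesgue_measure R \x m)%E).
- by move=> k; rewrite -[X in measurable X]setTI; exact: measurable_rV_cons.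
- apply/trivIsetP => /= i j _ _ ij; rewrite -preimage_setI.
  by move/trivIsetP : tF => /(_ _ _ _ _ ij) ->//; rewrite preimage_set0.
- rewrite -preimage_bigcup -[X in measurable X]setTI.
  exact: measurable_rV_cons.
Qed.

HB.instance Definition _ := isMeasure.Build _ _ _
  lebesgue_step step0 step_ge0 step_sigma_additive.

Let step_sigma_finite : sigma_finite setT lebesgue_step.
Proof.
have /sigma_finiteP[F [FT ndF Foo]] := sigma_finiteT (@lebesgue_measure R).
have /sigma_finiteP[G [GT ndG Goo]] := sigma_finiteT m.
exists (fun k => @rV_uncons n @^-1` (F k `*` G k)).
  rewrite -preimage_bigcup (_ : \bigcup_k _ = setT) ?preimage_setT//.
  apply/seteqP; split=> // -[x y] _.
  have [i _ Fx] : (\bigcup_k F k) x by rewrite -FT.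
  have [j _ Gy] : (\bigcup_k G k) y by rewrite -GT.
  exists (maxn i j) => //; split => /=.
  - by move: x Fx; exact/subsetPset/ndF/leq_maxl.
  - by move: y Gy; exact/subsetPset/ndG/leq_maxr.
move=> k; have [mF Foo'] := Foo k; have [mG Goo'] := Goo k; split.
  rewrite -[X in measurable X]setTI; apply: measurable_rV_uncons => //.
  exact: measurableX.
rewrite /lebesgue_step /pushforward -comp_preimage.
suff -> : @rV_uncons n \o @rV_cons n = id.
  by rewrite preimage_id product_measure1E// lte_mul_pinfty// ge0_fin_numE.
by apply/funext => p; exact: rV_consK.
Qed.

HB.instance Definition _ := Measure_isSigmaFinite.Build _ _ _ lebesgue_step
  step_sigma_finite.

End step.

Fixpoint lebesgue_rV (n : nat) : {sigma_finite_measure set 'rV[R]_n -> \bar R} :=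
  match n with
  | 0 => \d_(0 : 'rV[R]_0)
  | k.+1 => lebesgue_step (lebesgue_rV k)
  end.

End lebesgue_measure_rV.

Section definitions.
Context (R : realType).

Definition dotr n (x y : 'rV[R]_n) : R := \sum_(i < n) x ord0 i * y ord0 i.

Definition convex_body n (K : set 'rV[R]_n) : Prop :=
  [/\ convex_set (K : set (convex_lmodType 'rV[R]_n)), compact K & K° !=set0].

Definition origin_symmetric n (K : set 'rV[R]_n) : Prop :=
  forall x, K x -> K (- x).

(** The [sup] is a maximum when [K] is compact and nonempty. *)
Definition support_fun n (K : set 'rV[R]_n) (x : 'rV[R]_n) : R :=
  sup [set dotr x y | y in K].

(** The [sup] is a maximum when [K] and [Om] are convex bodies. *)
Definition aniso_inradius n (K Om : set 'rV[R]_n) : R :=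
  sup [set t : R | exists2 x, Om x & [set x + t *: y | y in K] `<=` Om].

Definition partial n (i : 'I_n) (f : 'rV[R]_n -> R) : 'rV[R]_n -> R :=
  fun x => 'D_(delta_mx ord0 i) f x.

Definition iter_partial n (s : seq 'I_n) (f : 'rV[R]_n -> R) : 'rV[R]_n -> R :=
  foldr (@partial n) f s.

Definition gradient n (f : 'rV[R]_n -> R) (x : 'rV[R]_n) : 'rV[R]_n :=
  \row_i partial i f x.

Definition hessian n (f : 'rV[R]_n -> R) (x : 'rV[R]_n) : 'M[R]_n :=
  \matrix_(i, j) iter_partial [:: i; j] f x.

(** [f] is of class C^k on the open set [V]: all iterated partial derivatives
    of order at most [k] exist and are continuous on [V].  The derivability
    clause is needed because ['D_v f x] is a total operator. *)
Definition Ck_on n (k : nat) (V : set 'rV[R]_n) (f : 'rV[R]_n -> R) : Prop :=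
  forall s : seq 'I_n,
    ((size s <= k)%N ->
      forall x, V x -> {for x, continuous (iter_partial s f)}) /\
    ((size s < k)%N ->
      forall x, V x -> forall i,
        derivable (iter_partial s f) x (delta_mx ord0 i)).

Definition posdef n (A : 'M[R]_n) : Prop :=
  forall v : 'rV[R]_n, v != 0 -> 0 < (v *m A *m v^T) ord0 ord0.

(** Near each boundary point, after an orthogonal change of coordinates
    [z = y *m Q], the boundary is the graph of the first coordinate of [z] as a
    C^2 function, with positive definite Hessian, of the remaining [n] ones. *)
Definition C2plus_regular n (K : set 'rV[R]_n.+1) : Prop :=
  forall x, (closure K `\` K°) x ->
  exists (Q : 'M[R]_n.+1) (U : set 'rV[R]_n.+1) (V : set 'rV[R]_n)
         (f : 'rV[R]_n -> R),
    [/\ Q *m Q^T = 1%:M, nbhs x U, open V,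
        Ck_on 2 V f /\ (forall w, V w -> posdef (hessian f w)) &
        forall y, U y ->
          let z := y *m Q : 'rV[R]_(1 + n) in
          (closure K `\` K°) y <->
          V (rsubmx z) /\ (lsubmx z) ord0 ord0 = f (rsubmx z)].

Definition test_function n (D : set 'rV[R]_n) (phi : 'rV[R]_n -> R) : Prop :=
  [/\ forall k, Ck_on k setT phi,
      compact (closure [set x | phi x != 0]) &
      closure [set x | phi x != 0] `<=` D].

Definition in_L2 n (D : set 'rV[R]_n) (u : 'rV[R]_n -> R) : Prop :=
  measurable_fun D u /\
  (\int[lebesgue_rV R n]_(x in D) ((u x) ^+ 2)%:E < +oo)%E.

Definition weak_gradient n (D : set 'rV[R]_n) (u : 'rV[R]_n -> R)
    (g : 'rV[R]_n -> 'rV[R]_n) : Prop :=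
  forall phi, test_function D phi -> forall i : 'I_n,
    \int[lebesgue_rV R n]_(x in D) (u x * partial i phi x) =
    - \int[lebesgue_rV R n]_(x in D) (g x ord0 i * phi x).

(** An element of W^{1,2}(D), for [D] open, is represented by a function [u]
    together with its weak gradient [g]; both matter only almost everywhere
    on [D]. *)
Definition W12 n (D : set 'rV[R]_n) (u : 'rV[R]_n -> R)
    (g : 'rV[R]_n -> 'rV[R]_n) : Prop :=
  [/\ in_L2 D u, forall i : 'I_n, in_L2 D (fun x => g x ord0 i) &
      weak_gradient D u g].

Definition W12_sqdist n (D : set 'rV[R]_n)
    (u : 'rV[R]_n -> R) (g : 'rV[R]_n -> 'rV[R]_n)
    (v : 'rV[R]_n -> R) (h : 'rV[R]_n -> 'rV[R]_n) : \bar R :=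
  (\int[lebesgue_rV R n]_(x in D)
     ((u x - v x) ^+ 2 + dotr (g x - h x) (g x - h x))%:E)%E.

(** The closure of the test functions in W^{1,2}(D). *)
Definition W012 n (D : set 'rV[R]_n) (u : 'rV[R]_n -> R)
    (g : 'rV[R]_n -> 'rV[R]_n) : Prop :=
  W12 D u g /\
  exists phi : nat -> 'rV[R]_n -> R,
    (forall k, test_function D (phi k)) /\
    (fun k => W12_sqdist D (phi k) (gradient (phi k)) u g) @ \oo --> 0%E.

(** The infimum is a minimum when [K] and [Om] are convex bodies, [K] being
    origin-symmetric. *)
Definition principal_frequency n (K Om : set 'rV[R]_n) : \bar R :=
  ereal_inf [set q : \bar R | exists u g,
    [/\ W012 Om° u g,
        ~ {ae lebesgue_rV R n, forall x, Om° x -> u x = 0} &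
        q = ((\int[lebesgue_rV R n]_(x in Om°) (support_fun K (g x)) ^+ 2) /
             (\int[lebesgue_rV R n]_(x in Om°) (u x) ^+ 2))%:E]].

End definitions.

(* Main.v *)
Require Import Defs.
From HB Require Import structures.
From mathcomp Require Import all_boot all_order all_algebra.
From mathcomp Require Import ring lra.
From mathcomp Require Import all_classical all_reals all_analysis.
From mathcomp Require Import measurable_realfun.

Set Implicit Arguments.
Unset Strict Implicit.
Unset Printing Implicit Defensive.

Import Order.TTheory GRing.Theory Num.Theory.
Import numFieldNormedType.Exports.

Local Open Scope classical_set_scope.
Local Open Scope ring_scope.

(** [Om] lies in finitely many supporting half-spaces
    [0 <= l_i x := b_i - a_i . x], normalized by [h_K (a_i) = 1], such that at
    every point of [Om] the smallest gap [l_i] is below any prescribed [rho]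
    larger than the inradius.  Let [e_i] be the point of [K] with
    [a_i . e_i = 1].  Following Hersch, use the field
    [V = - alpha cot (alpha d) e_i], where [alpha = pi / (2 rho)], [d] is the
    smallest gap and [i] its index: for a test function [phi] one has
    [h_K (grad phi)^2 >= alpha^2 phi^2 + div (phi^2 V)] pointwise, because
    [a_j . e_i <= 1] for all [j], i.e. no gap decreases faster than [l_i] along
    [e_i].  To keep [V] smooth, [d] is replaced by a log-sum-exp regularization
    and [e_i] by the corresponding weighted mean; the error terms have a good
    sign.  Integrating kills the divergence, and density extends the inequality
    from test functions to [W^{1,2}_0]. *)

(** * Sup norm, topology and Borel sets on row vectors *)

Section row_vectors.
Context (R : realType).

Lemma rV_norm_ge n (x : 'rV[R]_n) i : `|x ord0 i| <= `|x|.
Proof.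
rewrite [leRHS]/Num.norm /= mx_normrE; apply/bigmax_geP; right => /=.
by exists (ord0, i).
Qed.

Lemma rV_norm_le n (x : 'rV[R]_n) (M : R) :
  0 <= M -> (forall i, `|x ord0 i| <= M) -> `|x| <= M.
Proof.
move=> M0 xM; rewrite [leLHS]/Num.norm /= mx_normrE; apply/bigmax_leP; split=> //=.
by move=> [i j] _; rewrite (ord1 i); exact: xM.
Qed.

Lemma rV_continuous_at (T : topologicalType) n (f : T -> 'rV[R]_n) (x : T) :
  (forall i, {for x, continuous (fun y => f y ord0 i)}) ->
  {for x, continuous f}.
Proof.
move=> cf; apply/cvgrPdist_le => e e0.
have : \forall y \near x, forall i, `|f x ord0 i - f y ord0 i| <= e.
  apply: filter_forall => i; have /cvgrPdist_le/(_ _ e0) := cf i; exact.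
apply: filterS => y fy; apply: rV_norm_le; first exact: ltW.
by move=> i; rewrite !mxE.
Qed.

Lemma rV_ball_measurable n (x : 'rV[R]_n) (e : R) :
  0 < e -> measurable [set y : 'rV[R]_n | `|x - y| < e].
Proof.
move=> e0.
have -> : [set y : 'rV[R]_n | `|x - y| < e] =
    \bigcap_(i in [set: 'I_n]) [set y : 'rV[R]_n | `|x ord0 i - y ord0 i| < e].
  apply/seteqP; split => y /= xy.
    move=> i _ /=; apply: le_lt_trans xy.
    by have := rV_norm_ge (x - y) i; rewrite !mxE.
  rewrite [ltLHS]/Num.norm /= mx_normrE; apply/bigmax_ltP; split => //= -[i j] _.
  by rewrite (ord1 i) !mxE; exact: (xy j).
apply: fin_bigcap_measurable => // i _.
rewrite (_ : [set _ | _] =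
  (fun y : 'rV[R]_n => y ord0 i) @^-1` ball (x ord0 i) e) //.
rewrite -[X in measurable X]setTI; apply: measurable_coord => //.
by apply: open_measurable; exact: ball_open.
Qed.

(** The sigma-algebra comes from the coordinates and the topology from the sup norm. A ball is a
    finite intersection of coordinate slabs, and an open set is the countable union of the balls
    with rational centre and radius [1 / (k + 1)] that it contains. *)
Lemma rV_open_measurable n (U : set 'rV[R]_n) : open U -> measurable U.
Proof.
move=> oU.
pose F (q : 'rV[rat]_n * nat) : set 'rV[R]_n :=
  [set y | `|map_mx ratr q.1 - y| < q.2.+1%:R^-1].
have -> : U = \bigcup_(q in [set: 'rV[rat]_n * nat])
    (if asbool (F q `<=` U) then F q else set0).
  apply/seteqP; split => [x Ux|x [q _]]; last first.
    by case: asboolP => // FU Fx; exact: FU.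
  have /nbhs_ballP[e /= e0 eU] : nbhs x U by exact: open_nbhs_nbhs.
  (* With [d = 1 / (k + 1)] and [2 d <= e], a centre at distance less than [d] from [x] has a
     [d]-ball that contains [x] and stays inside the [e]-ball around [x]. *)
  have [k ke] : exists k : nat, 2 * k.+1%:R^-1 <= e.
    have [k /ltW] := ltr_add_invr (divr_gt0 e0 (ltr0n _ 2)).
    by rewrite add0r ler_pdivlMr// mulrC => ke; exists k.
  have k0 : 0 < k.+1%:R^-1 :> R by [].
  set d := k.+1%:R^-1 in ke k0.
  have ex i : exists r : rat, `|x ord0 i - ratr r| < d / 2.
    have [r] : exists r : rat,
        ratr r \in `]x ord0 i - d / 2, x ord0 i + d / 2[.
      by apply: rat_in_itvoo; lra.
    by rewrite in_itv /= => ?; exists r; rewrite ltr_norml; lra.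
  pose q : 'rV[rat]_n := \row_i projT1 (cid (ex i)).
  have Fx : F (q, k) x.
    rewrite /F /= -/d; apply: (@le_lt_trans _ _ (d / 2)); last by lra.
    apply: rV_norm_le => [|i]; first by lra.
    by rewrite !mxE distrC; case: cid => r /= /ltW.
  exists (q, k) => //; case: asboolP => // -[].
  move=> y /= Fy; apply: eU; rewrite -ball_normE /=.
  rewrite (_ : x - y = - (map_mx ratr q - x) + (map_mx ratr q - y)); last first.
    by rewrite opprB addrA subrK.
  apply: (le_lt_trans (ler_normD _ _)); rewrite normrN.
  apply: lt_le_trans ke; rewrite mulr_natl mulr2n; apply: ltrD => //.
apply: countable_bigcupT_measurable => // -[q k].
by case: ifP => _ //; exact: rV_ball_measurable.
Qed.

Lemma rV_continuous_measurable n (f : 'rV[R]_n -> R) :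
  continuous f -> measurable_fun setT f.
Proof.
move=> cf; apply: (measurability _ (RGenOpens.measurableE R)) => //.
move=> _ [_ [a [b ->] <-]]; rewrite setTI.
apply: rV_open_measurable; by apply: open_comp => // x _; exact: cf.
Qed.

End row_vectors.

(** * Integrals of functions with bounded support, and of their partial derivatives *)

Lemma bounded_support_integrable d (T : measurableType d) (R : realType)
    (mu : {measure set T -> \bar R}) (A : set T) (f : T -> R) (C : R) :
  measurable A -> (mu A < +oo)%E -> measurable_fun setT f ->
  (forall x, `|f x| <= C) -> (forall x, ~ A x -> f x = 0) ->
  mu.-integrable setT (EFin \o f).
Proof.
move=> mA fA mf fC f0.
have -> : EFin \o f = (EFin \o f) \_ A.
  apply/funext => x; rewrite /patch; case: ifPn => // /negP xA /=.
  by rewrite f0// => Ax; apply: xA; rewrite inE.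
apply/(integrable_mkcond _ mA).1/measurable_bounded_integrable => //.
- exact: measurable_funS mf.
- exists C; split; first exact: num_real.
  by move=> x Cx y _; exact: le_trans (fC y) (ltW Cx).
Qed.

Section lebesgue_rV_integral.
Context (R : realType).

Definition rV_box n (M : R) : set 'rV[R]_n :=
  [set x | forall i, `|x ord0 i| <= M].

Arguments rV_box : clear implicits.

Lemma rV_box_measurable n M : measurable (rV_box n M).
Proof.
rewrite (_ : rV_box n M = \bigcap_(i in [set: 'I_n])
    ((fun y : 'rV[R]_n => y ord0 i) @^-1` `[- M, M])); last first.
  apply/seteqP; split => x /= xM => [i _ /=|i].
    by rewrite in_itv/= -ler_norml.
  by have := xM i Logic.I; rewrite /= in_itv/= -ler_norml.
apply: fin_bigcap_measurable => // i _.
by rewrite -[X in measurable X]setTI; exact: measurable_coord.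
Qed.

Lemma norm_rV_box n M (x : 'rV[R]_n) : `|x| <= M -> rV_box n M x.
Proof. by move=> xM i; exact: le_trans (rV_norm_ge x i) xM. Qed.

Lemma rV_cons0 n (p : R * 'rV[R]_n) : rV_cons p ord0 ord0 = p.1.
Proof. exact: (congr1 fst (rV_consK p)). Qed.

Lemma rV_consS n (p : R * 'rV[R]_n) i : rV_cons p ord0 (lift ord0 i) = p.2 ord0 i.
Proof.
rewrite (_ : lift ord0 i = rshift 1 i); last exact: val_inj.
exact: row_mxEr.
Qed.

Lemma rV_box_cons n M (p : R * 'rV[R]_n) :
  rV_box n.+1 M (rV_cons p) <-> `|p.1| <= M /\ rV_box n M p.2.
Proof.
split => [pM|[tM yM] i].
  split; first by rewrite -rV_cons0.
  by move=> i; rewrite -rV_consS.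
by case: (unliftP ord0 i) => [j ->|->]; rewrite ?rV_consS// rV_cons0.
Qed.

Lemma rV_box_finite n (M : R) : 0 <= M -> (lebesgue_rV R n (rV_box n M) < +oo)%E.
Proof.
move=> M0; elim: n => [|n ih]/=.
  by rewrite /dirac indicE; case: (_ \in _); rewrite ltry.
rewrite /lebesgue_step /pushforward.
rewrite (_ : _ @^-1` _ = `[- M, M] `*` rV_box n M); last first.
  by apply/seteqP; split => p /=; rewrite rV_box_cons in_itv/= -ler_norml.
rewrite product_measure1E//; last exact: rV_box_measurable.
have lM : (lebesgue_measure [set` `[(- M)%R, M]] < +oo)%E.
  by rewrite lebesgue_measure_itv/=; case: ifP => // _; rewrite -EFinB ltry.
by rewrite lte_mul_pinfty// ge0_fin_numE.
Qed.

Lemma rV_cons_continuousr n t : continuous (fun y : 'rV[R]_n => rV_cons (t, y)).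
Proof.
move=> y; apply: rV_continuous_at => i.
case: (unliftP ord0 i) => [j ->|->].
  rewrite (_ : (fun _ => _) = (fun y : 'rV[R]_n => y ord0 j)).
    exact: coord_continuous.
  by apply/funext => z; rewrite rV_consS.
rewrite (_ : (fun _ => _) = (fun=> t)); first exact: cst_continuous.
by apply/funext => z; rewrite rV_cons0.
Qed.

Lemma rV_cons_continuousl n (y : 'rV[R]_n) :
  continuous (fun t : R => rV_cons (t, y)).
Proof.
move=> t; apply: rV_continuous_at => i.
case: (unliftP ord0 i) => [j ->|->].
  rewrite (_ : (fun _ => _) = (fun=> y ord0 j)); first exact: cst_continuous.
  by apply/funext => z; rewrite rV_consS.
rewrite (_ : (fun _ => _) = id); first by move=> ?; exact: cvg_id.
by apply/funext => z; rewrite rV_cons0.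
Qed.

Lemma rV_cons_lin n (h : R) (p q : R * 'rV[R]_n) :
  h *: rV_cons p + rV_cons q = rV_cons (h * p.1 + q.1, h *: p.2 + q.2).
Proof.
apply/rowP => i; case: (unliftP ord0 i) => [j ->|->].
  by rewrite mxE [X in X + _]mxE !rV_consS/= !mxE.
by rewrite mxE [X in X + _]mxE !rV_cons0.
Qed.

Lemma delta_rV_cons0 n :
  delta_mx ord0 ord0 = rV_cons (1, 0) :> 'rV[R]_n.+1.
Proof.
apply/rowP => i; case: (unliftP ord0 i) => [j ->|->].
  by rewrite rV_consS !mxE.
by rewrite rV_cons0 mxE.
Qed.

Lemma delta_rV_consS n j :
  delta_mx ord0 (lift ord0 j) = rV_cons (0, delta_mx ord0 j) :> 'rV[R]_n.+1.
Proof.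
apply/rowP => i; case: (unliftP ord0 i) => [k ->|->].
  by rewrite rV_consS !mxE (inj_eq lift_inj).
by rewrite rV_cons0 mxE.
Qed.

(** A directional derivative depends only on the restriction to a line. This transports derivatives
    between a function of several variables and its slices. *)
Lemma is_derive_line (V W : normedModType R) (f : V -> R) (g : W -> R)
    (x v : V) (y w : W) (df : R) :
  (forall h : R, f (h *: v + x) = g (h *: w + y)) ->
  is_derive x v f df -> is_derive y w g df.
Proof.
move=> fg [+ +].
have fg0 : f x = g y by have := fg 0; rewrite !scale0r !add0r.
have E : (fun h : R => h^-1 *: ((f \o shift x) (h *: v) - f x)) =
         (fun h : R => h^-1 *: ((g \o shift y) (h *: w) - g y)).
  by apply/funext => h /=; rewrite fg fg0.
by rewrite /derivable /derive E => ? ?; split.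
Qed.

Lemma continuous_bounded_support n (f : 'rV[R]_n -> R) (M : R) :
  continuous f -> (forall x, ~ rV_box n M x -> f x = 0) ->
  exists C, forall x, `|f x| <= C.
Proof.
move=> cf f0.
(* Taking the absolute value of [M] keeps 0 in the box even when [M] is negative. *)
have cB : compact (rV_box n `|M|).
  rewrite (_ : rV_box _ _ = [set v | forall i, `[- `|M|, `|M|]%classic (v ord0 i)]).
    apply: (@rV_compact _ _ (fun=> `[- `|M|, `|M|]%classic)) => i.
    exact: segment_compact.
  by apply/seteqP; split => x /= xM i; have := xM i;
    rewrite in_itv/= ler_norml.
have [] := @EVT_max_rV R n (fun x => `|f x|) (rV_box n `|M|) _ cB.
- by exists 0 => i; rewrite mxE normr0.
- apply: continuous_subspaceT => x; apply: continuous_comp; first exact: cf.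
  exact: norm_continuous.
move=> c _ fc; exists `|f c| => x.
have [xM|xM] := pselect (rV_box n `|M| x); first by apply: fc; rewrite inE.
rewrite f0 ?normr0// => xM'; apply: xM => i.
exact: le_trans (xM' i) (ler_norm M).
Qed.

Lemma rV_integrable n (f : 'rV[R]_n -> R) (M : R) :
  continuous f -> (forall x, ~ rV_box n M x -> f x = 0) ->
  (lebesgue_rV R n).-integrable setT (EFin \o f).
Proof.
move=> cf f0; have [C fC] := continuous_bounded_support cf f0.
apply: (@bounded_support_integrable _ _ _ _ (rV_box n `|M|) f C) => //.
- exact: rV_box_measurable.
- exact: rV_box_finite.
- exact: rV_continuous_measurable.
- move=> x xM; apply: f0 => xM'; apply: xM => i.
  exact: le_trans (xM' i) (ler_norm M).
Qed.

Lemma integral_derive1_bounded_support (f g : R -> R) (M : R) :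
  (forall x : R, is_derive x 1 f (g x)) -> continuous g ->
  (forall x, M < `|x| -> f x = 0) -> (forall x, M < `|x| -> g x = 0) ->
  (\int[lebesgue_measure]_x (g x)%:E = 0)%E.
Proof.
(* The endpoints must lie strictly beyond [M], since [f] is only known to vanish where [M] is
   exceeded. *)
move=> fg cg f0 g0; pose N : R := `|M| + 1.
have N0 : 0 < N by rewrite /N ltr_wpDl.
have MN : M < N by rewrite (le_lt_trans (ler_norm M))// ltrDl.
have cf : continuous f.
  move=> x; apply/differentiable_continuous/derivable1_diffP.
  by have [] := fg x.
transitivity (\int[lebesgue_measure]_(x in `[(- N)%R, N]) (g x)%:E)%E.
  rewrite [RHS]integral_mkcond; apply: eq_integral => x _.
  rewrite /patch; case: ifPn => // /negP xN; rewrite g0//.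
  rewrite (lt_le_trans MN)// leNgt; apply/negP => /ltW xN'; apply: xN.
  by rewrite inE/= in_itv/= -ler_norml.
rewrite (@continuous_FTC2 _ g f).
- by rewrite !f0 ?subee// ?normrN gtr0_norm.
- by rewrite gtrN.
- by apply: continuous_subspaceT.
- split.
  + by move=> x _; have [] := fg x.
  + exact/cvg_at_right_filter/cf.
  + exact/cvg_at_left_filter/cf.
- by move=> x _; rewrite derive1E; have [] := fg x.
Qed.

(** The divergence theorem without boundary term, by induction on the dimension. The measure is the
    image of a product, so Fubini applies: a derivative along the first coordinate is integrated
    along it first and vanishes by the fundamental theorem of calculus; any other one vanishes on
    each slice by induction. *)
Theorem integral_partial_bounded_support n (f g : 'rV[R]_n -> R) (j : 'I_n) (M : R) :
  (forall x, is_derive x (delta_mx ord0 j) f (g x)) -> continuous g ->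
  (forall x, ~ rV_box n M x -> f x = 0) ->
  (forall x, ~ rV_box n M x -> g x = 0) ->
  (\int[lebesgue_rV R n]_x (g x)%:E = 0)%E.
Proof.
elim: n f g j => [f g []//|n ih f g j fg cg f0 g0].
have [C gC] := continuous_bounded_support cg g0.
have mg := rV_continuous_measurable cg.
have ig : (@lebesgue_measure R \x lebesgue_rV R n)%E.-integrable setT
    ((EFin \o g) \o @rV_cons R n).
  apply: (@bounded_support_integrable _ _ _ _
    (@rV_cons R n @^-1` rV_box n.+1 `|M|) (g \o @rV_cons R n) C) => //.
  - rewrite -[X in measurable X]setTI; apply: measurable_rV_cons => //.
    exact: rV_box_measurable.
  - exact: (@rV_box_finite n.+1 `|M|).
  - apply: measurableT_comp => //; exact: measurable_rV_cons.
  - by move=> p; exact: gC.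
  - move=> p /= pM; apply: g0 => pM'; apply: pM => i.
    exact: le_trans (pM' i) (ler_norm M).
have -> : (\int[lebesgue_rV R n.+1]_x (g x)%:E =
    \int[@lebesgue_measure R \x lebesgue_rV R n]_p (g (rV_cons p))%:E)%E.
  rewrite /= /lebesgue_step.
  rewrite (integral_pushforward (@measurable_rV_cons R n))//.
  exact/measurable_EFinP.
have out (t : R) (y : 'rV[R]_n) :
    M < `|t| \/ ~ rV_box n M y -> ~ rV_box n.+1 M (rV_cons (t, y)).
  by move=> H /rV_box_cons[/= tM yM]; case: H => //; rewrite ltNge tM.
case: (unliftP ord0 j) => [k jk|j0]; last first.
  rewrite -(integral12_prod_meas1 ig) (Fubini ig).
  rewrite integral0_eq// => y _.
  apply: (@integral_derive1_bounded_support (fun t => f (rV_cons (t, y))) _ M).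
  - move=> t; have := fg (rV_cons (t, y)).
    apply: is_derive_line => h; rewrite j0 delta_rV_cons0 rV_cons_lin/=.
    by rewrite scaler0 add0r.
  - move=> t; apply: continuous_comp; last exact: cg.
    exact: rV_cons_continuousl.
  - by move=> t tM; apply: f0; apply: out; left.
  - by move=> t tM; apply: g0; apply: out; left.
rewrite -(integral12_prod_meas1 ig) integral0_eq// => t _.
apply: (ih (fun y => f (rV_cons (t, y))) _ k).
- move=> y; have := fg (rV_cons (t, y)).
  apply: is_derive_line => h; rewrite jk delta_rV_consS rV_cons_lin/=.
  by rewrite mulr0 add0r.
- move=> y; apply: continuous_comp; last exact: cg.
  exact: rV_cons_continuousr.
- by move=> y yM; apply: f0; apply: out; right.
- by move=> y yM; apply: g0; apply: out; right.
Qed.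

End lebesgue_rV_integral.

Arguments rV_box : clear implicits.

(** * The Euclidean product of row vectors *)

Section dot_product.
Context (R : realType) (n : nat).
Implicit Types x y z : 'rV[R]_n.

Lemma dotrC x y : dotr x y = dotr y x.
Proof. by apply: eq_bigr => i _; rewrite mulrC. Qed.

Lemma dotrDl x y z : dotr (x + y) z = dotr x z + dotr y z.
Proof. by rewrite -big_split; apply: eq_bigr => i _; rewrite mxE mulrDl. Qed.

Lemma dotrZl c x z : dotr (c *: x) z = c * dotr x z.
Proof. by rewrite mulr_sumr; apply: eq_bigr => i _; rewrite mxE mulrA. Qed.

Lemma dotrNl x z : dotr (- x) z = - dotr x z.
Proof. by rewrite -scaleN1r dotrZl mulN1r. Qed.

Lemma dotrBl x y z : dotr (x - y) z = dotr x z - dotr y z.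
Proof. by rewrite dotrDl dotrNl. Qed.

Lemma dotrDr x y z : dotr z (x + y) = dotr z x + dotr z y.
Proof. by rewrite dotrC dotrDl !(dotrC z). Qed.

Lemma dotrZr c x z : dotr z (c *: x) = c * dotr z x.
Proof. by rewrite dotrC dotrZl (dotrC z). Qed.

Lemma dotrNr x z : dotr z (- x) = - dotr z x.
Proof. by rewrite dotrC dotrNl (dotrC z). Qed.

Lemma dotrBr x y z : dotr z (x - y) = dotr z x - dotr z y.
Proof. by rewrite dotrDr dotrNr. Qed.

Lemma dotr_sumr (I : finType) (w : I -> R) (f : I -> 'rV[R]_n) x :
  dotr x (\sum_i w i *: f i) = \sum_i w i * dotr x (f i).
Proof.
rewrite /dotr; under eq_bigr do rewrite summxE mulr_sumr.
rewrite exchange_big; apply: eq_bigr => i _; rewrite mulr_sumr.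
by apply: eq_bigr => j _; rewrite mxE mulrCA.
Qed.

Lemma dotr0l x : dotr 0 x = 0.
Proof. by rewrite -(scale0r 0) dotrZl mul0r. Qed.

Lemma dotrr_ge0 x : 0 <= dotr x x.
Proof. by apply: sumr_ge0 => i _; rewrite -expr2 sqr_ge0. Qed.

Lemma dotrr_gt0 x : x != 0 -> 0 < dotr x x.
Proof.
move=> x0; rewrite lt_neqAle dotrr_ge0 andbT eq_sym; apply: contra x0.
rewrite psumr_eq0; last by move=> i _; rewrite -expr2 sqr_ge0.
move=> /allP xx; apply/eqP/rowP => i; rewrite mxE.
have := xx i (mem_index_enum _); rewrite -expr2 sqrf_eq0; exact: eqP.
Qed.

(** A substitute for Cauchy-Schwarz: the norm here is the sup norm, hence the dimension as
    constant. *)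
Lemma ler_norm_dotr x y : `|dotr x y| <= n%:R * `|x| * `|y|.
Proof.
apply: (le_trans (ler_norm_sum _ _ _)).
apply: (@le_trans _ _ (\sum_(i < n) `|x| * `|y|)); last first.
  by rewrite sumr_const card_ord -mulrA mulr_natl.
by apply: ler_sum => i _; rewrite normrM ler_pM// rV_norm_ge.
Qed.

Lemma sqr_norm_le_dotrr x : `|x| ^+ 2 <= dotr x x.
Proof.
have D0 := dotrr_ge0 x.
rewrite -[leRHS]sqr_sqrtr// ler_pXn2r ?nnegrE ?sqrtr_ge0//.
apply: rV_norm_le; rewrite ?sqrtr_ge0// => i.
rewrite -sqrtr_sqr ler_wsqrtr// /dotr (bigD1 i)//= -expr2 lerDl.
by apply: sumr_ge0 => j _; rewrite -expr2 sqr_ge0.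
Qed.

Lemma sum_continuous (T : topologicalType) (m : nat) (f : 'I_m -> T -> R) (t : T) :
  (forall i, {for t, continuous (f i)}) ->
  {for t, continuous (fun s => \sum_(i < m) f i s)}.
Proof.
move=> cf; rewrite /prop_for /continuous_at; apply: cvg_big => //.
  by move=> [a b]; exact: add_continuous.
by move=> i _; exact: cf.
Qed.

Lemma dotr_continuous_comp (T : topologicalType) (f g : T -> 'rV[R]_n) (t : T) :
  {for t, continuous f} -> {for t, continuous g} ->
  {for t, continuous (fun s => dotr (f s) (g s))}.
Proof.
move=> cf cg; apply: sum_continuous => i; apply: continuousM.
  apply: (@continuous_comp _ _ _ f (fun x : 'rV[R]_n => x ord0 i)) => //.
  exact: coord_continuous.
apply: (@continuous_comp _ _ _ g (fun x : 'rV[R]_n => x ord0 i)) => //.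
exact: coord_continuous.
Qed.

Lemma dotr_continuousr x : continuous (dotr x).
Proof.
by move=> y; apply: dotr_continuous_comp; [exact: cst_continuous|exact: cvg_id].
Qed.

Lemma affine_continuous x (b : R) : continuous (fun y => b - dotr x y).
Proof.
move=> y; apply: (@continuousB _ _ _ (fun=> b) (dotr x)).
  exact: cst_continuous.
exact: dotr_continuousr.
Qed.

End dot_product.

(** * Separation of a point from a compact convex set *)

Section convexity.
Context (R : realType) (n : nat).
Implicit Types A K : set 'rV[R]_n.

Lemma convex_setP A : convex_set (A : set (convex_lmodType 'rV[R]_n)) ->
  forall x y (t : R), 0 <= t <= 1 -> A x -> A y -> A (t *: x + (1 - t) *: y).
Proof.
move=> cA x y t t01 Ax Ay.
have := cA x y (Itv01 (andP t01).1 (andP t01).2).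
by rewrite !inE => /(_ Ax Ay).
Qed.

(* The functional is [y - z], where [z] is the point of [A] nearest to [y]. *)
Lemma convex_separation A y :
  convex_set (A : set (convex_lmodType 'rV[R]_n)) -> compact A -> A !=set0 ->
  ~ A y -> exists a, forall x, A x -> dotr a x < dotr a y.
Proof.
move=> cA coA A0 Ay.
have [] := @EVT_min_rV R n (fun x => dotr (y - x) (y - x)) A A0 coA.
  apply: continuous_subspaceT => x.
  have cB : {for x, continuous (fun z : 'rV[R]_n => y - z)}.
    by apply: continuousB; [exact: cst_continuous|exact: cvg_id].
  exact: (dotr_continuous_comp cB cB).
move=> z; rewrite inE => Az zmin; exists (y - z) => x Ax.
have a0 : 0 < dotr (y - z) (y - z).
  by apply: dotrr_gt0; rewrite subr_eq0; apply/eqP => yz; rewrite yz in Ay.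
suff : dotr (y - z) (x - z) <= 0.
  by move: a0; rewrite !dotrBr; lra.
rewrite leNgt; apply/negP => xz0.
set p := dotr (y - z) (x - z) in xz0; set q := dotr (x - z) (x - z).
have q0 : 0 <= q by exact: dotrr_ge0.
(* This [t] lies in []0, 1]] and satisfies [t * q <= p]. Moving from [z] towards [x] by [t] changes
   the squared distance to [y] by [- 2 t p + t^2 q < 0], against the minimality of [z]. *)
pose t := p / (p + q).
have pq : 0 < p + q by lra.
have t0 : 0 < t by rewrite divr_gt0.
have t1 : t <= 1 by rewrite ler_pdivrMr// mul1r lerDl.
have tq : t * (p + q) = p by rewrite divfK// gt_eqF.
have := zmin (t *: x + (1 - t) *: z).
rewrite inE => /(_ (convex_setP cA _ Ax Az)); rewrite (ltW t0) t1 => /(_ isT).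
rewrite (_ : y - (t *: x + (1 - t) *: z) = (y - z) - t *: (x - z)); last first.
  by apply/rowP => i; rewrite !mxE; ring.
have E u v : dotr (u - t *: v) (u - t *: v) =
    dotr u u - 2 * t * dotr u v + t ^+ 2 * dotr v v.
  by rewrite dotrBl !dotrBr !dotrZr !dotrZl [dotr v u]dotrC; ring.
by rewrite E -/p -/q; nra.
Qed.

End convexity.

(** * The support function of a symmetric convex body is a continuous norm *)

Section support_function.
Context (R : realType) (n : nat) (K : set 'rV[R]_n).
Hypotheses (convK : convex_body K) (symK : origin_symmetric K).
Local Notation h := (support_fun K).

Lemma convex_body_nonempty : K !=set0.
Proof. by have [_ _ [x /nbhs_singleton Kx]] := convK; exists x. Qed.

Lemma convex_body_bounded : exists2 M : R, 0 < M & forall y, K y -> `|y| <= M.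
Proof.
have [_ cK _] := convK.
have [M [_ KM]] := compact_bounded cK.
exists (`|M| + 1) => [|y Ky]; first by rewrite ltr_wpDl.
by apply: (KM (`|M| + 1)) => //; rewrite (le_lt_trans (ler_norm M))// ltrDl.
Qed.

Lemma support_has_sup v : has_sup [set dotr v y | y in K].
Proof.
have [M M0 KM] := convex_body_bounded.
have [y0 Ky0] := convex_body_nonempty.
split; first by exists (dotr v y0), y0.
exists (n%:R * `|v| * M) => _ [y Ky <-].
apply: (le_trans (ler_norm _)); apply: (le_trans (ler_norm_dotr _ _)).
by rewrite ler_wpM2l ?mulr_ge0//; exact: KM.
Qed.

Lemma support_ge v y : K y -> dotr v y <= h v.
Proof. by move=> Ky; apply: (ub_le_sup (support_has_sup v).2); exists y. Qed.

Lemma support_attained v : exists2 e, K e & dotr v e = h v.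
Proof.
have [_ cK _] := convK.
have [] := @EVT_max_rV R n (dotr v) K convex_body_nonempty cK.
  by apply: continuous_subspaceT; exact: dotr_continuousr.
move=> e; rewrite inE => Ke emax; exists e => //; apply/eqP.
rewrite eq_le support_ge//= ge_sup//; first exact: (support_has_sup v).1.
by move=> _ [y Ky <-]; apply: emax; rewrite inE.
Qed.

Lemma support_norm v y : K y -> `|dotr v y| <= h v.
Proof.
by move=> Ky; rewrite ler_norml lerNl -dotrNr !support_ge//; exact: symK.
Qed.

Lemma support_ge0 v : 0 <= h v.
Proof.
have [y Ky] := convex_body_nonempty.
exact: le_trans (support_norm v Ky).
Qed.

Lemma supportZ t v : 0 <= t -> h (t *: v) = t * h v.
Proof.
move=> t0; apply/eqP; rewrite eq_le; apply/andP; split.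
  have [e Ke <-] := support_attained (t *: v).
  by rewrite dotrZl ler_wpM2l// support_ge.
have [e Ke <-] := support_attained v.
by rewrite -dotrZl support_ge.
Qed.

Lemma supportD u v : h (u + v) <= h u + h v.
Proof.
have [e Ke <-] := support_attained (u + v).
by rewrite dotrDl lerD// support_ge.
Qed.

Lemma support_le_norm : exists2 C, 0 <= C & forall v, h v <= C * `|v|.
Proof.
have [M M0 KM] := convex_body_bounded.
exists (n%:R * M) => [|v]; first by rewrite mulr_ge0// ltW.
have [e Ke <-] := support_attained v.
apply: (le_trans (ler_norm _)); apply: (le_trans (ler_norm_dotr _ _)).
by rewrite [leRHS]mulrAC ler_wpM2l ?mulr_ge0// KM.
Qed.

(** The function is Lipschitz: by subadditivity [h u - h v] is at most [h (u - v)], which the norm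
    of [u - v] controls. *)
Lemma support_continuous : continuous h.
Proof.
have [C C0 hC] := support_le_norm.
have hlip u v : `|h u - h v| <= C * `|u - v|.
  rewrite ler_norml lerNl opprB !lerBlDr.
  have := supportD (u - v) v; have := supportD (v - u) u; rewrite !subrK.
  have := hC (u - v); have := hC (v - u); rewrite (distrC v u); lra.
move=> v; apply/(@cvgrPdist_le _ _ _ (nbhs v) (nbhs_filter v)) => e e0.
have : \forall u \near v, `|v - u| <= e / (C + 1).
  apply/nbhs_ballP; exists (e / (C + 1)); first by rewrite /= divr_gt0// ltr_wpDl.
  by move=> u; rewrite -ball_normE /= => /ltW.
apply: filterS => u uv; apply: (le_trans (hlip v u)).
apply: (le_trans (ler_wpM2l C0 uv)).
by rewrite mulrA ler_pdivrMr ?ltr_wpDl// mulrC ler_pM2l// lerDl.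
Qed.

(** If [x0] is interior, [v] is the midpoint of [x0 + v] and [- (x0 - v)], and symmetry puts both in
    [K] for small [v]. *)
Lemma convex_body_ball : exists2 r, 0 < r & forall v, `|v| < r -> K v.
Proof.
have [cK _ [x0 /nbhs_ballP[r /= r0 rK]]] := convK.
exists r => // v vr.
have K1 : K (x0 + v).
  by apply: rK; rewrite -ball_normE /= opprD addrA subrr sub0r normrN.
have K2 : K (- (x0 - v)).
  by apply: symK; apply: rK; rewrite -ball_normE /= opprB addrC subrK.
have := convex_setP cK (t := 2^-1) _ K1 K2.
rewrite (_ : _ *: _ + _ = v); last by apply/rowP => i; rewrite !mxE; lra.
by apply; lra.
Qed.

(** A small positive multiple of [v] belongs to [K], and its product with [v] is positive. *)
Lemma support_gt0 v : v != 0 -> 0 < h v.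
Proof.
move=> v0; have [r r0 rK] := convex_body_ball.
have nv : 0 < `|v| by rewrite normr_gt0.
pose t := r / (2 * `|v|).
have t0 : 0 < t by rewrite divr_gt0// mulr_gt0.
have Kv : K (t *: v).
  apply: rK; rewrite normrZ gtr0_norm// (_ : t * _ = r / 2); first by lra.
  by rewrite /t; field; exact: lt0r_neq0.
apply: lt_le_trans (support_ge v Kv).
by rewrite dotrZr mulr_gt0// dotrr_gt0.
Qed.

Lemma support0 : h 0 = 0.
Proof. by rewrite -(scale0r (0 : 'rV[R]_n)) supportZ// mul0r. Qed.

End support_function.

(** * Supporting half-spaces and the anisotropic inradius *)

Section half_spaces.
Context (R : realType) (n : nat) (K Om : set 'rV[R]_n.+1).
Hypotheses (convK : convex_body K) (symK : origin_symmetric K).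
Hypothesis convOm : convex_body Om.
Local Notation h := (support_fun K).

Let radii := [set t : R | exists2 x, Om x & [set x + t *: y | y in K] `<=` Om].

Lemma aniso_inradius_has_sup : has_sup radii.
Proof.
split.
  have [x Ox] := convex_body_nonempty convOm.
  by exists 0, x => // _ [y Ky <-]; rewrite scale0r addr0.
have [r r0 rK] := convex_body_ball convK symK.
have [M M0 OM] := convex_body_bounded convOm.
(* In positive dimension this is a nonzero point of [K]. Both [x] and [x + t *: k] lie in the
   bounded set [Om], which bounds [t]. *)
pose k : 'rV[R]_n.+1 := const_mx (r / 2).
have nk : r / 2 <= `|k|.
  have := rV_norm_ge k ord0; rewrite mxE; apply: le_trans; exact: ler_norm.
have Kk : K k.
  apply: rK; apply: (@le_lt_trans _ _ (r / 2)); last by lra.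
  apply: rV_norm_le => [|i]; first by lra.
  by rewrite mxE ger0_norm//; lra.
exists (2 * M / (r / 2)) => t [x Ox xK].
have := OM _ (xK _ (ex_intro2 _ _ k Kk erefl)) => xk.
rewrite ler_pdivlMr ?divr_gt0//.
have : `|t| * `|k| <= 2 * M.
  rewrite -normrZ (_ : t *: k = (x + t *: k) - x); last by rewrite addrC addKr.
  have := OM _ Ox; have := ler_normB (x + t *: k) x; lra.
apply: le_trans; apply: (@le_trans _ _ (`|t| * (r / 2))).
  by rewrite ler_wpM2r ?ler_norm//; lra.
by rewrite ler_wpM2l.
Qed.

Lemma aniso_inradius_ge0 : 0 <= aniso_inradius K Om.
Proof.
have [x Ox] := convex_body_nonempty convOm.
apply: (ub_le_sup aniso_inradius_has_sup.2); exists x => // _ [y Ky <-].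
by rewrite scale0r addr0.
Qed.

(** As [r] exceeds the inradius, some [x + r *: y] with [y] in [K] lies outside [Om]. A functional
    separating it from [Om], scaled to support value 1 and pushed until it touches [Om], has gap at
    [x] below [r * dotr a y], hence below [r]. *)
Lemma supporting_half_space x (r : R) : Om x -> aniso_inradius K Om < r ->
  exists a b, [/\ h a = 1, forall y, Om y -> dotr a y <= b & b - dotr a x < r].
Proof.
move=> Ox Rr; have r0 := le_lt_trans aniso_inradius_ge0 Rr.
have [y Ky Oy] : exists2 y, K y & ~ Om (x + r *: y).
  apply: contrapT => H; move: Rr; rewrite ltNge; apply/negP; rewrite negbK.
  apply: (ub_le_sup aniso_inradius_has_sup.2); exists x => // _ [y Ky <-].
  by apply: contrapT => Oy; apply: H; exists y.
have [cO coO _] := convOm.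
have O0 := convex_body_nonempty convOm.
have [a aO] := convex_separation cO coO O0 Oy.
have a0 : a != 0.
  apply/eqP => a0; have := aO _ Ox; rewrite a0 !dotr0l ltxx; exact: notF.
have ha := support_gt0 convK symK a0.
have [z Oz az] := support_attained convOm a.
exists ((h a)^-1 *: a), ((h a)^-1 * dotr a z); split.
- by rewrite supportZ ?invr_ge0 ?ltW// mulVf ?gt_eqF.
- move=> w Ow; rewrite dotrZl ler_wpM2l ?invr_ge0 ?(ltW ha)// az.
  exact: support_ge.
- rewrite dotrZl -mulrBr mulrC ltr_pdivrMr//.
  have := aO _ Oz; rewrite dotrDr dotrZr.
  have : r * dotr a y <= r * h a by rewrite ler_wpM2l ?(ltW r0)// support_ge.
  by lra.
Qed.

(** For each half-space the points with gap below [r] form an open set; these sets cover the compact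
    [Om], so finitely many suffice. *)
Lemma half_space_cover (r : R) : aniso_inradius K Om < r ->
  exists m (a : 'I_m -> 'rV[R]_n.+1) (b : 'I_m -> R),
    [/\ forall i, h (a i) = 1, forall i y, Om y -> dotr (a i) y <= b i &
        forall y, Om y -> exists i, b i - dotr (a i) y < r].
Proof.
move=> Rr.
pose D : set ('rV[R]_n.+1 * R) :=
  [set p | h p.1 = 1 /\ forall y, Om y -> dotr p.1 y <= p.2].
pose f (p : 'rV[R]_n.+1 * R) := [set y | p.2 - dotr p.1 y < r].
have [_ + _] := convOm; rewrite compact_cover => /(_ _ D f) [].
- move=> p _; apply: (@open_comp _ _ (fun y => p.2 - dotr p.1 y) [set t | t < r]).
    by move=> y _; exact: affine_continuous.
  exact: open_lt.
- move=> x Ox; have [a [b [ha ab abx]]] := supporting_half_space Ox Rr.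
  by exists (a, b).
move=> F FD cov; pose D' := finmap.enum_fset F; exists (size D'), (fun i => (tnth (in_tuple D') i).1),
  (fun i => (tnth (in_tuple D') i).2).
have DD i : D (tnth (in_tuple D') i).
  by have := FD _ (mem_tnth i (in_tuple D')); rewrite inE.
split => [i|i|y Oy]; [exact: (DD i).1|exact: (DD i).2|].
have [p pD' fp] := cov y Oy.
have /tnthP[i pi] : p \in in_tuple D' by [].
by exists i; rewrite -pi.
Qed.

(** The normal is nonzero because [h a = 1], so a small move along it stays in [Om] and strictly
    decreases the gap. *)
Lemma half_space_interior (a : 'rV[R]_n.+1) (b : R) :
  h a = 1 -> (forall y, Om y -> dotr a y <= b) ->
  forall y, Om° y -> 0 < b - dotr a y.
Proof.
move=> ha ab y /nbhs_ballP[r /= r0 rO].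
have a0 : a != 0.
  by apply: contra_eq_neq ha => ->; rewrite support0// eq_sym oner_eq0.
have na : 0 < `|a| by rewrite normr_gt0.
pose t := r / (2 * `|a|).
have t0 : 0 < t by rewrite divr_gt0// mulr_gt0.
have /ab : Om (y + t *: a).
  apply: rO; rewrite -ball_normE /= opprD addrA subrr sub0r normrN.
  rewrite normrZ gtr0_norm// (_ : t * _ = r / 2); first by lra.
  by rewrite /t; field; exact: lt0r_neq0.
have := mulr_gt0 t0 (dotrr_gt0 a0).
by rewrite dotrDr dotrZr; lra.
Qed.

(** Each gap attains a positive minimum on [S], and there are finitely many gaps. Applied to the
    support of a test function, this keeps the argument of the cotangent away from its pole at 0. *)
Lemma half_space_margin m (a : 'I_m -> 'rV[R]_n.+1) (b : 'I_m -> R) S :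
  (forall i, h (a i) = 1) -> (forall i y, Om y -> dotr (a i) y <= b i) ->
  compact S -> S `<=` Om° ->
  exists2 d, 0 < d & forall i y, S y -> d <= b i - dotr (a i) y.
Proof.
move=> ha ab cS SO.
have margin i : exists2 e, 0 < e & forall y, S y -> e <= b i - dotr (a i) y.
  have [S0|S0] := pselect (S !=set0); last first.
    by exists 1 => // y Sy; exfalso; apply: S0; exists y.
  have [] := @EVT_min_rV R n.+1 (fun y => b i - dotr (a i) y) S S0 cS.
    by apply: continuous_subspaceT; exact: affine_continuous.
  move=> c; rewrite inE => Sc cmin; exists (b i - dotr (a i) c).
    by apply: half_space_interior => //; [exact: ab|exact: SO].
  by move=> y Sy; apply: cmin; rewrite inE.
have : \forall d \near (0 : R)^'+, forall i y, S y -> d <= b i - dotr (a i) y.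
  apply: filter_forall => i; have [e e0 eS] := margin i.
  near=> d => y Sy; apply: le_trans (eS _ Sy).
  by near: d; exact: nbhs_right_le.
move=> H; near (0 : R)^'+ => d; exists d => //.
by near: d.
Unshelve. all: by end_near. Qed.

End half_spaces.

(** * Rules for directional derivatives *)

Section directional_calculus.
Context (R : realType) (V : normedModType R).
Implicit Types (f g : V -> R) (x v : V).

(** Only a directional derivative of [f] is given, so the chain rule is applied on the line
    [t *: v + x], where it is one-dimensional. *)
Lemma is_derive_comp1 f (g : R -> R) x v (df dg : R) :
  is_derive (f x) 1 g dg -> is_derive x v f df ->
  is_derive x v (g \o f) (dg * df).
Proof.
move=> gdg fdf.
have E (h : R) : h *: v + x = h * 1 *: v + x by rewrite mulr1.
have fline : is_derive (0 : R) 1 (fun t : R => f (t *: v + x)) df.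
  by move: fdf; apply: is_derive_line => h; rewrite addr0 -E.
have : is_derive (0 : R) 1 (g \o (fun t : R => f (t *: v + x))) (dg * df).
  by apply: is_derive1_comp; rewrite scale0r add0r.
by apply: is_derive_line => h /=; rewrite addr0 -E.
Qed.

Lemma is_derive_sub f g x v (df dg : R) : is_derive x v f df ->
  is_derive x v g dg -> is_derive x v (fun y => f y - g y) (df - dg).
Proof. exact: is_deriveB. Qed.

Lemma is_derive_mul f g x v (df dg : R) : is_derive x v f df ->
  is_derive x v g dg ->
  is_derive x v (fun y => f y * g y) (f x * dg + g x * df).
Proof. exact: is_deriveM. Qed.

Lemma is_derive_scale f x v (k df : R) : is_derive x v f df ->
  is_derive x v (fun y => k * f y) (k * df).
Proof. exact: is_deriveZ. Qed.

Lemma is_derive_bigsum m (f : 'I_m -> V -> R) x v (df : 'I_m -> R) :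
  (forall i, is_derive x v (f i) (df i)) ->
  is_derive x v (fun y => \sum_(i < m) f i y) (\sum_(i < m) df i).
Proof.
move=> fdf; have := is_derive_sum fdf.
by rewrite (_ : \sum_(i < m) f i = fun y => \sum_(i < m) f i y)//;
  apply/funext => y; rewrite fct_sumE.
Qed.

End directional_calculus.

Lemma is_derive_affine (R : realType) n (a x v : 'rV[R]_n) (b : R) :
  is_derive x v (fun y => b - dotr a y) (- dotr a v).
Proof.
have : is_derive (0 : R) (1 : R) (fun t : R => b - dotr a x - dotr a v * t)
    (- dotr a v).
  apply: is_derive_eq (is_derive_sub (is_derive_cst _ _ _)
    (is_derive_scale _ (is_derive_id (0 : R) (1 : R)))) _.
  by rewrite mulr1 sub0r.
by apply: is_derive_line => h; rewrite dotrDr dotrZr addr0 [_ *: 1]mulr1; ring.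
Qed.

(** * The regularized minimum of the gaps and its softmax weights *)

Section smooth_min.
Context (R : realType) (n m : nat).
Variables (a : 'I_m -> 'rV[R]_n) (b : 'I_m -> R) (eps : R).

Definition half_gap i (x : 'rV[R]_n) := b i - dotr (a i) x.

Definition exp_sum x := \sum_(i < m) expR (- eps^-1 * half_gap i x).

(* Log-sum-exp regularization of the minimum of the [half_gap i]. *)
Definition smooth_min x := - eps * ln (exp_sum x).

(** These are the softmax weights of the gaps, normalized through [smooth_min]; in this form
    positivity and the derivative are immediate. *)
Definition weight i x := expR (eps^-1 * (smooth_min x - half_gap i x)).

Hypotheses (m0 : (0 < m)%N) (eps0 : 0 < eps).

Lemma exp_sum_gt0 x : 0 < exp_sum x.
Proof.
rewrite /exp_sum (bigD1 (Ordinal m0))//= ltr_pwDl ?expR_gt0//.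
by apply: sumr_ge0 => i _; exact: expR_ge0.
Qed.

Lemma weightE i x : weight i x = expR (- eps^-1 * half_gap i x) / exp_sum x.
Proof.
rewrite /weight /smooth_min mulrBr expRD -mulNr.
rewrite mulrA mulrN mulVf ?gt_eqF// mulN1r expRN lnK ?posrE ?exp_sum_gt0//.
by rewrite mulrC.
Qed.

Lemma weight_gt0 i x : 0 < weight i x.
Proof. exact: expR_gt0. Qed.

Lemma sum_weight x : \sum_(i < m) weight i x = 1.
Proof.
under eq_bigr do rewrite weightE.
by rewrite -mulr_suml divff// gt_eqF// exp_sum_gt0.
Qed.

(** The weights are positive with sum 1, so each is at most 1, and its exponent is therefore
    nonpositive. *)
Lemma smooth_min_le i x : smooth_min x <= half_gap i x.
Proof.
rewrite -subr_le0 -(pmulr_rle0 _ (x := eps^-1)) ?invr_gt0//.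
rewrite -ler_expR expR0 -/(weight i x) -(sum_weight x) (bigD1 i)//= lerDl.
by apply: sumr_ge0 => j _; exact/ltW/weight_gt0.
Qed.

(** The exponential sum has [m] terms, each at most [expR (- d / eps)]; taking logarithms costs
    [eps * ln m]. *)
Lemma smooth_min_ge x (d : R) : (forall i, d <= half_gap i x) ->
  d - eps * ln m%:R <= smooth_min x.
Proof.
move=> dx.
have m1 : 0 < m%:R :> R by rewrite ltr0n.
have : exp_sum x <= m%:R * expR (- eps^-1 * d).
  rewrite mulr_natl -[X in _ *+ X](card_ord m) -sumr_const; apply: ler_sum => i _.
  by rewrite ler_expR !mulNr lerN2 ler_pM2l ?invr_gt0.
rewrite -ler_ln ?posrE ?exp_sum_gt0 ?mulr_gt0 ?expR_gt0//.
rewrite lnM ?posrE ?expR_gt0// expRK => /(ler_wpM2l (ltW eps0)).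
rewrite mulrDr mulrA mulrN mulfV ?gt_eqF// mulN1r /smooth_min mulNr.
lra.
Qed.

Lemma half_gap_continuous i : continuous (half_gap i).
Proof. exact: affine_continuous. Qed.

Lemma exp_sum_continuous : continuous exp_sum.
Proof.
move=> x; apply: (@sum_continuous _ _ _ (fun i x => expR (- eps^-1 * half_gap i x))) => i.
apply: (@continuous_comp _ _ _ (fun x => - eps^-1 * half_gap i x) expR).
  apply: (@continuousM _ _ (fun=> - eps^-1) (half_gap i)).
    exact: cst_continuous.
  exact: half_gap_continuous.
exact: continuous_expR.
Qed.

Lemma smooth_min_continuous : continuous smooth_min.
Proof.
move=> x; rewrite /smooth_min.
apply: (@continuousM _ _ (fun=> - eps) (fun x => ln (exp_sum x))).
  exact: cst_continuous.
exact: (continuous_comp (@exp_sum_continuous x)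
  (continuous_ln (exp_sum_gt0 x))).
Qed.

Lemma weight_continuous i : continuous (weight i).
Proof.
move=> x; rewrite /weight.
apply: (@continuous_comp _ _ _
  (fun x => eps^-1 * (smooth_min x - half_gap i x)) expR); last first.
  exact: continuous_expR.
apply: (@continuousM _ _ (fun=> eps^-1) (fun x => smooth_min x - half_gap i x)).
  exact: cst_continuous.
apply: (@continuousB _ _ _ smooth_min (half_gap i)).
  exact: smooth_min_continuous.
exact: half_gap_continuous.
Qed.

Lemma is_derive_smooth_min x v :
  is_derive x v smooth_min (- \sum_(i < m) weight i x * dotr (a i) v).
Proof.
have H := is_derive_scale (- eps) (is_derive_comp1
  (is_derive1_ln (exp_sum_gt0 x))
  (is_derive_bigsum (fun i => is_derive_comp1 (is_derive_expR _)
    (is_derive_scale (- eps^-1) (is_derive_affine (a i) x v (b i)))))).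
refine (is_derive_eq (H : is_derive _ _ smooth_min _) _).
rewrite !mulr_sumr -sumrN.
apply: eq_bigr => i _; rewrite weightE /half_gap.
by field; rewrite !gt_eqF// exp_sum_gt0.
Qed.

Lemma is_derive_weight i x v :
  is_derive x v (weight i) (weight i x * (eps^-1 *
    (dotr (a i) v - \sum_(k < m) weight k x * dotr (a k) v))).
Proof.
have H := is_derive_comp1 (is_derive_expR _) (is_derive_scale (eps^-1)
  (is_derive_sub (is_derive_smooth_min x v)
    (is_derive_affine (a i) x v (b i)))).
refine (is_derive_eq (H : is_derive _ _ (weight i) _) _).
by rewrite opprK [- _ + _]addrC.
Qed.

End smooth_min.

(** * The scaled cotangent *)

Section cotangent.
Context (R : realType) (alpha : R).

(** The logarithmic derivative of [sin (alpha * y)], which for [alpha = pi / (2 rho)] is the first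
    eigenfunction on [[0, rho]] with Dirichlet condition at 0 and Neumann condition at [rho]. It
    solves the Riccati equation [c' = - (alpha^2 + c^2)]. *)
Definition cot_alpha (y : R) := alpha * (cos (alpha * y) / sin (alpha * y)).

Lemma is_derive_cot_alpha y : sin (alpha * y) != 0 ->
  is_derive y 1 cot_alpha (- (alpha / sin (alpha * y)) ^+ 2).
Proof.
move=> s0.
have D : is_derive y 1 (fun y : R => alpha * y) alpha.
  by apply: is_derive_eq (is_derive_scale _ (is_derive_id _ _)) _; exact: mulr1.
have dc := is_derive_comp1 (is_derive_cos (alpha * y)) D.
have ds := is_derive_comp1 (is_derive_sin (alpha * y)) D.
have di := is_deriveV s0 ds.
have H := is_derive_scale alpha (is_derive_mul dc di).
refine (is_derive_eq (H : is_derive _ _ cot_alpha _) _).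
have := cos2Dsin2 (alpha * y); rewrite /= /GRing.scale /=.
set s := sin _; set c := cos _ => cs.
rewrite (_ : - (alpha / s) ^+ 2 = - (alpha ^+ 2 * (c ^+ 2 + s ^+ 2) / s ^+ 2)).
  by field.
by rewrite cs; field.
Qed.

Lemma cot_alpha_continuous y : sin (alpha * y) != 0 ->
  {for y, continuous cot_alpha}.
Proof.
move=> s0; apply/differentiable_continuous/derivable1_diffP.
by have [] := is_derive_cot_alpha s0.
Qed.

End cotangent.

(** * The regularized Hersch field and its pointwise inequality *)

Section hersch_field.
Context (R : realType) (n m : nat).
Variables (a e : 'I_m -> 'rV[R]_n) (b : 'I_m -> R) (eps alpha : R).
Hypotheses (m0 : (0 < m)%N) (eps0 : 0 < eps).

Local Notation d := (smooth_min a b eps).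
Local Notation w := (weight a b eps).

Definition mean_normal x := \sum_(i < m) w i x *: a i.
Definition mean_direction x := \sum_(i < m) w i x *: e i.

Definition hersch_field x := - cot_alpha alpha (d x) *: mean_direction x.

(** The [j]-th partial derivative of the [j]-th coordinate of the field, so that summing over [j]
    gives the divergence. The first term differentiates the weights, the second the cotangent. *)
Definition hersch_div (j : 'I_n) x :=
  - (cot_alpha alpha (d x) / eps) *
    (\sum_(i < m) w i x * ((a i - mean_normal x) ord0 j * e i ord0 j)) -
  (alpha / sin (alpha * d x)) ^+ 2 *
    (mean_normal x ord0 j * mean_direction x ord0 j).

Lemma dotr_delta (x : 'rV[R]_n) j : dotr x (delta_mx ord0 j) = x ord0 j.
Proof.
rewrite /dotr (bigD1 j)//= mxE !eqxx mulr1 big1 ?addr0// => i ij.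
by rewrite mxE (negbTE ij) andbF mulr0.
Qed.

Lemma mean_normal_coord x j :
  mean_normal x ord0 j = \sum_(i < m) w i x * dotr (a i) (delta_mx ord0 j).
Proof.
by rewrite /mean_normal summxE; apply: eq_bigr => i _; rewrite mxE dotr_delta.
Qed.

Lemma mean_direction_coord x j :
  mean_direction x ord0 j = \sum_(i < m) w i x * e i ord0 j.
Proof. by rewrite /mean_direction summxE; apply: eq_bigr => i _; rewrite mxE. Qed.

Lemma is_derive_hersch_field j x : sin (alpha * d x) != 0 ->
  is_derive x (delta_mx ord0 j) (fun y => hersch_field y ord0 j)
    (hersch_div j x).
Proof.
move=> s0.
have dd := is_derive_smooth_min a b m0 eps0 x (delta_mx ord0 j).
have dc := is_derive_scale (-1) (is_derive_comp1 (is_derive_cot_alpha s0) dd).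
have dw i := is_derive_scale (e i ord0 j)
  (is_derive_weight a b m0 eps0 i x (delta_mx ord0 j)).
have H := is_derive_mul dc (is_derive_bigsum dw).
rewrite (_ : (fun y => _) =
    fun y => -1 * (cot_alpha alpha \o d) y * \sum_(i < m) e i ord0 j * w i y).
  refine (is_derive_eq H _).
  rewrite /hersch_div -mean_normal_coord mean_direction_coord.
  rewrite (eq_bigr (fun i => eps^-1 *
      (w i x * ((a i - mean_normal x) ord0 j * e i ord0 j)))); last first.
    by move=> i _; rewrite !mxE dotr_delta; ring.
  rewrite -mulr_sumr [\sum_(i < m) e i ord0 j * w i x](eq_bigr
    (fun i => w i x * e i ord0 j)); last by move=> i _; rewrite mulrC.
  by rewrite /=; ring.
apply/funext => y; rewrite mxE mean_direction_coord /= mulN1r; congr (_ * _).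
by apply: eq_bigr => i _; rewrite mulrC.
Qed.

Lemma mean_normal_continuous x j : {for x, continuous (fun y => mean_normal y ord0 j)}.
Proof.
rewrite (_ : (fun y => _) =
  fun y => \sum_(i < m) w i y * dotr (a i) (delta_mx ord0 j)); last first.
  by apply/funext => y; rewrite mean_normal_coord.
apply: sum_continuous => i.
apply: (@continuousM _ _ (w i) (fun=> dotr (a i) (delta_mx ord0 j))).
  exact: weight_continuous.
exact: cst_continuous.
Qed.

Lemma mean_direction_continuous x j :
  {for x, continuous (fun y => mean_direction y ord0 j)}.
Proof.
rewrite (_ : (fun y => _) =
  fun y => \sum_(i < m) w i y * e i ord0 j); last first.
  by apply/funext => y; rewrite mean_direction_coord.
apply: sum_continuous => i.
apply: (@continuousM _ _ (w i) (fun=> e i ord0 j)).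
  exact: weight_continuous.
exact: cst_continuous.
Qed.

Lemma cot_smooth_min_continuous x : sin (alpha * d x) != 0 ->
  {for x, continuous (fun y => cot_alpha alpha (d y))}.
Proof.
move=> s0; exact: (continuous_comp (smooth_min_continuous m0 (x := x))
  (cot_alpha_continuous s0)).
Qed.

Lemma hersch_field_continuous j x : sin (alpha * d x) != 0 ->
  {for x, continuous (fun y => hersch_field y ord0 j)}.
Proof.
move=> s0.
rewrite (_ : (fun y => _) =
  fun y => - cot_alpha alpha (d y) * mean_direction y ord0 j); last first.
  by apply/funext => y; rewrite mxE.
apply: (@continuousM _ _ (fun y => - cot_alpha alpha (d y))
  (fun y => mean_direction y ord0 j)); last exact: mean_direction_continuous.
apply: (@continuousN _ _ _ (fun y => cot_alpha alpha (d y))).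
exact: cot_smooth_min_continuous.
Qed.

Lemma hersch_div_continuous j x : sin (alpha * d x) != 0 ->
  {for x, continuous (hersch_div j)}.
Proof.
move=> s0; rewrite /hersch_div.
apply: (@continuousB _ _ _ (fun y => - (cot_alpha alpha (d y) / eps) * _)
  (fun y => (alpha / sin (alpha * d y)) ^+ 2 * _)).
  apply: (@continuousM _ _ (fun y => - (cot_alpha alpha (d y) / eps))).
    apply: (@continuousN _ _ _ (fun y => cot_alpha alpha (d y) / eps)).
    apply: (@continuousM _ _ (fun y => cot_alpha alpha (d y)) (fun=> eps^-1)).
      exact: cot_smooth_min_continuous.
    exact: cst_continuous.
  apply: sum_continuous => i.
  apply: (@continuousM _ _ (w i)
    (fun y => (a i - mean_normal y) ord0 j * e i ord0 j)).
    exact: weight_continuous.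
  apply: (@continuousM _ _ (fun y => (a i - mean_normal y) ord0 j)
    (fun=> e i ord0 j)); last exact: cst_continuous.
  rewrite (_ : (fun y => _) = fun y => a i ord0 j - mean_normal y ord0 j).
    apply: (@continuousB _ _ _ (fun=> a i ord0 j)); first exact: cst_continuous.
    exact: mean_normal_continuous.
  by apply/funext => y; rewrite !mxE.
apply: (@continuousM _ _ (fun y => (alpha / sin (alpha * d y)) ^+ 2)
  (fun y => mean_normal y ord0 j * mean_direction y ord0 j)); last first.
  apply: (@continuousM _ _ (fun y => mean_normal y ord0 j)).
    exact: mean_normal_continuous.
  exact: mean_direction_continuous.
have cq : {for x, continuous (fun y => alpha / sin (alpha * d y))}.
  apply: (@continuousM _ _ (fun=> alpha) (fun y => (sin (alpha * d y))^-1)).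
    exact: cst_continuous.
  apply: (@continuousV _ _ (fun y => sin (alpha * d y))) => //.
  apply: (@continuous_comp _ _ _ (fun y => alpha * d y) sin).
    apply: (@continuousM _ _ (fun=> alpha) d); first exact: cst_continuous.
    exact: smooth_min_continuous.
  exact: continuous_sin.
exact: (continuousM cq cq).
Qed.

(* Along [h], the field spends [- c^2 phi^2] by AM-GM, where [c] is the
   cotangent factor; since [c' = - (alpha^2 + c^2)], the divergence regains
   [- (alpha^2 + c^2) phi^2] once [eps] is small. *)
Lemma hersch_pointwise (h : 'rV[R]_n -> R) (g : 'rV[R]_n) (u : R) x :
  (forall i, dotr (a i) (e i) = 1) ->
  (forall i j, dotr (a i) (e j) <= 1) ->
  (forall i, `|dotr g (e i)| <= h g) ->
  0 < sin (alpha * d x) -> 0 < cos (alpha * d x) -> 0 < alpha ->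
  alpha * eps <= sin (alpha * d x) * cos (alpha * d x) ->
  alpha ^+ 2 * u ^+ 2 + (2 * u * dotr g (hersch_field x) +
    u ^+ 2 * \sum_(j < n) hersch_div j x) <= h g ^+ 2.
Proof.
move=> ae1 ae gh s0 c0 al0 epsc.
set M := dotr (mean_normal x) (mean_direction x).
have sw := sum_weight a b m0 eps0 x.
have ME : M = \sum_(i < m) w i x * dotr (mean_normal x) (e i).
  exact: dotr_sumr.
(* [M] is a double weighted mean of the products [dotr (a k) (e i)], all at most 1. *)
have M1 : M <= 1.
  rewrite ME -sw; apply: ler_sum => i _; rewrite ler_piMr ?(ltW (weight_gt0 _ _ _ _ _))//.
  rewrite dotrC dotr_sumr -sw; apply: ler_sum => k _.
  by rewrite ler_piMr ?(ltW (weight_gt0 _ _ _ _ _))// dotrC.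
set c := cot_alpha alpha (d x); set q := (alpha / sin (alpha * d x)) ^+ 2.
have divE : \sum_(j < n) hersch_div j x = - (c / eps) * (1 - M) - q * M.
  rewrite sumrB -!mulr_sumr -/M; congr (_ * _ - _).
  rewrite exchange_big/= (eq_bigr (fun i =>
      w i x - w i x * dotr (mean_normal x) (e i))).
    by rewrite sumrB sw -ME.
  move=> i _; rewrite -mulr_sumr -/(dotr _ _) dotrBl ae1; ring.
have qE : q = alpha ^+ 2 + c ^+ 2.
  have sN0 := lt0r_neq0 s0.
  have cs := cos2Dsin2 (alpha * d x).
  rewrite (_ : alpha ^+ 2 + c ^+ 2 = alpha ^+ 2 *
    (cos (alpha * d x) ^+ 2 + sin (alpha * d x) ^+ 2) / sin (alpha * d x) ^+ 2).
    by rewrite cs /q; field.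
  by rewrite /c /cot_alpha; field.
(* This is where [eps] must be small. Together with [M <= 1] it bounds the divergence above by
   [- q], so the error from the weights has the good sign. *)
have qc : q <= c / eps.
  rewrite -subr_ge0 (_ : _ - _ = alpha / (eps * sin (alpha * d x) ^+ 2) *
      (sin (alpha * d x) * cos (alpha * d x) - alpha * eps)).
    by rewrite mulr_ge0 ?subr_ge0// divr_ge0 ?mulr_ge0 ?exprn_ge0 ?ltW.
  by rewrite /c /q /cot_alpha; field; rewrite !lt0r_neq0.
rewrite dotrZr divE -/c; set D := dotr g _.
have /[!ler_norml]/andP[hD Dh] : `|D| <= h g.
  rewrite /D dotr_sumr; apply: (le_trans (ler_norm_sum _ _ _)).
  rewrite -[leRHS]mul1r -sw mulr_suml; apply: ler_sum => i _.
  by rewrite normrM gtr0_norm ?weight_gt0// ler_pM2l ?weight_gt0.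
(* It remains to combine [D^2 <= h(g)^2] with [(D + u c)^2 >= 0], after the terms [alpha^2 u^2]
   cancel by the formula for [q]. *)
have D2 : 0 <= (h g - D) * (h g + D) by apply: mulr_ge0; lra.
have Mqc : 0 <= (1 - M) * (c / eps - q) by apply: mulr_ge0; lra.
have uMqc := mulr_ge0 (sqr_ge0 u) Mqc.
have uq : u ^+ 2 * q = u ^+ 2 * alpha ^+ 2 + u ^+ 2 * c ^+ 2.
  by rewrite qE mulrDr.
have Dc := sqr_ge0 (D + u * c).
lra.
Qed.

End hersch_field.

(** * Test functions and their supports *)

Section test_functions.
Context (R : realType) (n : nat).
Implicit Types (f phi : 'rV[R]_n -> R) (D : set 'rV[R]_n).

Lemma near0_is_derive f x (v : 'rV[R]_n) :
  (\forall y \near x, f y = 0) -> is_derive x v f 0.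
Proof.
move=> f0; apply: near_eq_is_derive (is_derive_cst (0 : R) x v).
by apply: filterS f0 => y ->.
Qed.

Lemma near0_continuous f x :
  (\forall y \near x, f y = 0) -> {for x, continuous f}.
Proof.
move=> f0; have fx : f x = 0 := nbhs_singleton f0.
apply/(@cvgrPdist_le _ _ _ (nbhs x) (nbhs_filter x)) => e e0.
apply: (@filterS _ (nbhs x) (nbhs_filter x)) f0 => y ->.
by rewrite fx subrr normr0 ltW.
Qed.

Definition tsupport phi := closure [set x | phi x != 0].

Lemma tsupport_near0 phi x : ~ tsupport phi x -> \forall y \near x, phi y = 0.
Proof.
move=> Sx; have : nbhs x (~` tsupport phi).
  by apply: open_nbhs_nbhs; split => //; exact/closed_openC/closed_closure.
apply: filterS => y Sy; apply: contrapT => /eqP y0.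
by apply: Sy; exact: subset_closure.
Qed.

Lemma tsupport_eq0 phi x : ~ tsupport phi x -> phi x = 0.
Proof. by move=> /tsupport_near0/nbhs_singleton. Qed.

Variables (D : set 'rV[R]_n) (phi : 'rV[R]_n -> R).
Hypothesis tphi : test_function D phi.

Lemma test_function_continuous : continuous phi.
Proof. by have [/(_ 0%N [::])[+ _] _ _] := tphi => /(_ isT) H x; exact: H. Qed.

Lemma test_function_is_derive x (j : 'I_n) :
  is_derive x (delta_mx ord0 j) phi (partial j phi x).
Proof.
have [/(_ 1%N [::])[_ /(_ isT x Logic.I j)] + _ _] := tphi.
by move=> H; split.
Qed.

Lemma partial_continuous (j : 'I_n) : continuous (partial j phi).
Proof. by have [/(_ 1%N [:: j])[+ _] _ _] := tphi => /(_ isT) H x; exact: H. Qed.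

Lemma gradient_continuous : continuous (gradient phi).
Proof.
move=> x; apply: rV_continuous_at => i.
rewrite (_ : (fun y => _) = partial i phi); first exact: partial_continuous.
by apply/funext => y; rewrite mxE.
Qed.

Lemma gradient_eq0 x : ~ tsupport phi x -> gradient phi x = 0.
Proof.
move=> Sx; apply/rowP => i; rewrite !mxE.
have := near0_is_derive (delta_mx ord0 i) (tsupport_near0 Sx).
by move=> dphi; rewrite /partial derive_val.
Qed.

Lemma test_function_box : exists M, forall x, tsupport phi x -> rV_box R n M x.
Proof.
have [_ cS _] := tphi; have [M [_ SM]] := compact_bounded cS.
exists (`|M| + 1) => x Sx; apply: norm_rV_box.
by apply: (SM (`|M| + 1)) => //; rewrite (le_lt_trans (ler_norm M))// ltrDl.
Qed.

End test_functions.

(** * The divergence term integrates to zero *)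

Section hersch_test_function.
Context (R : realType) (n : nat) (K Om : set 'rV[R]_n.+1).
Hypotheses (convK : convex_body K) (symK : origin_symmetric K).
Hypothesis convOm : convex_body Om.
Local Notation h := (support_fun K).
Variable phi : 'rV[R]_n.+1 -> R.
Hypothesis tphi : test_function Om° phi.
Local Notation S := (tsupport phi).

(** [G j] is the [j]-th partial derivative of [phi^2 V j]. The field is regular only on the support
    of [phi], but at any other point [phi] vanishes in a whole neighbourhood, so the product is
    regular everywhere. *)
Lemma hersch_test_function_divergence (V dV : 'I_n.+1 -> 'rV[R]_n.+1 -> R) :
  (forall j x, S x -> is_derive x (delta_mx ord0 j) (V j) (dV j x)) ->
  (forall j x, S x -> {for x, continuous (V j)}) ->
  (forall j x, S x -> {for x, continuous (dV j)}) ->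
  let G j x := 2 * phi x * (partial j phi x * V j x) + phi x ^+ 2 * dV j x in
  (forall j, continuous (G j)) /\
  (forall j, (\int[lebesgue_rV R n.+1]_x (G j x)%:E = 0)%E).
Proof.
move=> dV_ cV cdV G.
have cp := test_function_continuous tphi.
have cG j : continuous (G j).
  move=> x; have [Sx|Sx] := pselect (S x); last first.
    apply: near0_continuous; apply: filterS (tsupport_near0 Sx) => y y0.
    by rewrite /G y0 mulr0 mul0r expr0n mul0r addr0.
  apply: (@continuousD _ _ _ (fun x => 2 * phi x * (partial j phi x * V j x))
    (fun x => phi x ^+ 2 * dV j x)).
    apply: (@continuousM _ _ (fun x => 2 * phi x) (fun x => partial j phi x * V j x)).
      by apply: (@continuousM _ _ (fun=> 2) phi); [exact: cst_continuous|exact: cp].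
    apply: (@continuousM _ _ (partial j phi) (V j)); last exact: cV.
    exact: (partial_continuous tphi).
  apply: (@continuousM _ _ (fun x => phi x ^+ 2) (dV j)); last exact: cdV.
  exact: (continuousM (cp x) (cp x)).
split=> // j; have [M SM] := test_function_box tphi.
have phi0 x : ~ rV_box R n.+1 M x -> phi x = 0.
  by move=> xM; apply: tsupport_eq0 => /SM.
apply: (@integral_partial_bounded_support _ _ (fun x => phi x * phi x * V j x)
  (G j) j M) => //.
- move=> x; have [Sx|Sx] := pselect (S x).
    have dp := test_function_is_derive tphi x j.
    refine (is_derive_eq (is_derive_mul (is_derive_mul dp dp) (dV_ j x Sx)) _).
    by rewrite /G; ring.
  rewrite /G (tsupport_eq0 Sx) mulr0 mul0r expr0n mul0r addr0.
  by apply: near0_is_derive; apply: filterS (tsupport_near0 Sx) => y ->; rewrite !mul0r.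
- by move=> x /phi0 ->; rewrite !mul0r.
- by move=> x /phi0 x0; rewrite /G x0 mulr0 mul0r expr0n mul0r addr0.
Qed.

End hersch_test_function.

(** * The integral inequality for test functions *)

Section hersch_inequality.
Context (R : realType) (n : nat) (K Om : set 'rV[R]_n.+1).
Hypotheses (convK : convex_body K) (symK : origin_symmetric K).
Hypothesis convOm : convex_body Om.
Local Notation h := (support_fun K).

(** Sine increases and cosine decreases on the first quadrant. Mixing the two endpoints gives a
    bound uniform in [y], although [sin y * cos y] is not monotone there. *)
Lemma sin_cos_lower_bound (x0 x y : R) : 0 < x0 -> x0 <= y -> y < x ->
  x < pi / 2 -> [/\ 0 < sin y, 0 < cos y & sin x0 * cos x <= sin y * cos y].
Proof.
move=> x00 x0y yx xpi; have p0 := pi_gt0 R.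
have sx0 : 0 < sin x0 by apply: sin_gt0_pihalf; lra.
have cx : 0 < cos x by apply: cos_gt0_pihalf; lra.
have sy : sin x0 <= sin y.
  move: x0y; rewrite le_eqVlt => /predU1P[->//|x0y].
  by rewrite ltW// ltr_sin// in_itv/=; lra.
have cy : cos x < cos y by rewrite ltr_cos// in_itv/=; lra.
split; [exact: lt_le_trans sy|exact: lt_trans cy|].
by apply: ler_pM => //; exact: ltW.
Qed.

Lemma integral_eq0_off (D : set 'rV[R]_n.+1) (f : 'rV[R]_n.+1 -> R) :
  (forall x, ~ D x -> f x = 0) ->
  (\int[lebesgue_rV R n.+1]_(x in D) (f x)%:E =
   \int[lebesgue_rV R n.+1]_x (f x)%:E)%E.
Proof.
move=> f0; rewrite integral_mkcond; apply: eq_integral => x _.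
rewrite /patch; case: ifPn => // /negP xD; rewrite f0// => Dx.
by apply: xD; rewrite inE.
Qed.

Lemma hersch_test_function (phi : 'rV[R]_n.+1 -> R) (rho : R) :
  test_function Om° phi -> aniso_inradius K Om < rho ->
  (((pi / (2 * rho)) ^+ 2)%:E *
     \int[lebesgue_rV R n.+1]_(x in Om°) (phi x ^+ 2)%:E <=
   \int[lebesgue_rV R n.+1]_(x in Om°) (h (gradient phi x) ^+ 2)%:E)%E.
Proof.
move=> tphi Rrho; have R0 := aniso_inradius_ge0 convK symK convOm.
have rho0 : 0 < rho by exact: le_lt_trans Rrho.
set alpha := pi / (2 * rho).
have al0 : 0 < alpha by rewrite divr_gt0 ?pi_gt0 ?mulr_gt0.
(* An intermediate radius: the cover gives gaps below [r], and [r < rho] keeps [alpha * r] strictly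
   below [pi / 2], where the cosine is positive. *)
pose r := (aniso_inradius K Om + rho) / 2.
have Rr : aniso_inradius K Om < r by rewrite /r; lra.
have rrho : r < rho by rewrite /r; lra.
have r0 : 0 < r by lra.
have [m [a [b [ha ab cov]]]] := half_space_cover convK symK convOm Rr.
have m0 : (0 < m)%N.
  have [y /cov[i _]] := convex_body_nonempty convOm.
  exact: leq_ltn_trans (ltn_ord i).
have [_ cS SO] := tphi.
have [dl' dl'0 dlS'] := half_space_margin convK ha ab cS SO.
(* Capping by [r] keeps [alpha * (dl / 2)] in the first quadrant too. *)
pose dl := Num.min dl' r.
have dl0 : 0 < dl by rewrite lt_min dl'0.
have dlr : dl <= r by rewrite ge_min lexx orbT.
have dlS i x : tsupport phi x -> dl <= half_gap a b i x.
  by move=> Sx; apply: le_trans (dlS' i x Sx); rewrite ge_min lexx.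
have SOm x : tsupport phi x -> Om x by move=> /SO; exact: interior_subset.
pose e i := s2val (cid2 (support_attained convK (a i))).
have Ke i : K (e i) by rewrite /e; case: cid2.
have ae1 i : dotr (a i) (e i) = 1 by rewrite /e; case: cid2 => y /= _ ->.
have ae i j : dotr (a i) (e j) <= 1 by rewrite -(ha i); exact: support_ge.
have alr : alpha * r < pi / 2.
  rewrite /alpha (_ : pi / 2 = pi / (2 * rho) * rho); first by rewrite ltr_pM2l.
  by field; exact: lt0r_neq0.
(* A lower bound for the product of sine and cosine on the support; it does not involve [eps], which
   can thus be chosen from it. *)
pose k := sin (alpha * (dl / 2)) * cos (alpha * r).
have lnm0 : 0 <= ln (m%:R : R) by rewrite ln_ge0// ler1n.
have k0 : 0 < k.
  have ald0 : 0 < alpha * (dl / 2) by rewrite mulr_gt0// divr_gt0.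
  have aldr : alpha * (dl / 2) <= alpha * r by rewrite ler_pM2l//; lra.
  have alr0 : 0 < alpha * r by rewrite mulr_gt0.
  by rewrite mulr_gt0//; [apply: sin_gt0_pihalf|apply: cos_gt0_pihalf]; lra.
(* The first bound is the smallness asked by the pointwise inequality. The second keeps [smooth_min]
   above [dl / 2]; its [+ 1] avoids dividing by [ln 1 = 0]. *)
pose eps := Num.min (k / alpha) (dl / (2 * (ln m%:R + 1))).
have eps0 : 0 < eps.
  rewrite lt_min divr_gt0//=; apply: divr_gt0 => //; lra.
have epsk : alpha * eps <= k.
  by rewrite mulrC -ler_pdivlMr// ge_min lexx.
have epsd : eps * ln m%:R <= dl / 2.
  apply: (@le_trans _ _ (eps * (ln m%:R + 1))).
    by rewrite ler_wpM2l ?(ltW eps0)// lerDl.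
  rewrite -ler_pdivlMr ?ltr_wpDl// ge_min; apply/orP; right.
  by rewrite invfM mulrA.
have trig x : tsupport phi x -> [/\ 0 < sin (alpha * smooth_min a b eps x),
    0 < cos (alpha * smooth_min a b eps x) &
    alpha * eps <= sin (alpha * smooth_min a b eps x) *
                   cos (alpha * smooth_min a b eps x)].
  move=> Sx.
  have d1 : dl / 2 <= smooth_min a b eps x.
    have := smooth_min_ge m0 eps0 (fun i => dlS i x Sx); lra.
  have d2 : smooth_min a b eps x < r.
    have [i ir] := cov x (SOm x Sx).
    exact: le_lt_trans (smooth_min_le a b m0 eps0 i x) ir.
  have x00 : 0 < alpha * (dl / 2) by rewrite mulr_gt0// divr_gt0.
  have x0y : alpha * (dl / 2) <= alpha * smooth_min a b eps x by rewrite ler_pM2l.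
  have yx : alpha * smooth_min a b eps x < alpha * r by rewrite ltr_pM2l.
  have [s0 c0 sc] := sin_cos_lower_bound x00 x0y yx alr.
  by split => //; exact: le_trans sc.
pose V j x := hersch_field a e b eps alpha x ord0 j.
pose dV j x := hersch_div a e b eps alpha j x.
have sN0 x : tsupport phi x -> sin (alpha * smooth_min a b eps x) != 0.
  by move=> /trig[/lt0r_neq0].
pose G j x := 2 * phi x * (partial j phi x * V j x) + phi x ^+ 2 * dV j x.
have [] : (forall j, continuous (G j)) /\
    (forall j, (\int[lebesgue_rV R n.+1]_x (G j x)%:E = 0)%E).
  apply: (hersch_test_function_divergence tphi).
  - by move=> j x Sx; apply: is_derive_hersch_field => //; exact: sN0.
  - by move=> j x Sx; apply: hersch_field_continuous => //; exact: sN0.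
  - by move=> j x Sx; apply: hersch_div_continuous => //; exact: sN0.
move=> cG iG.
have cphi := test_function_continuous tphi.
have [M SM] := test_function_box tphi.
have box0 x : ~ rV_box R n.+1 M x -> ~ tsupport phi x by move=> H /SM.
pose A x := alpha ^+ 2 * phi x ^+ 2.
have cA : continuous A.
  move=> x; apply: (@continuousM _ _ (fun=> alpha ^+ 2) (fun x => phi x ^+ 2)).
    exact: cst_continuous.
  exact: (continuousM (cphi x) (cphi x)).
have iA : (lebesgue_rV R n.+1).-integrable setT (EFin \o A).
  apply: (rV_integrable (M := M)) => // x /box0/tsupport_eq0.
  by rewrite /A => ->; rewrite expr0n mulr0.
have cH : continuous (fun x => h (gradient phi x) ^+ 2).
  move=> x; have ch : {for x, continuous (fun y => h (gradient phi y))}.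
    have cg : {for x, continuous (gradient phi)}.
      exact: (gradient_continuous tphi).
    have cs : {for gradient phi x, continuous h} by exact: support_continuous.
    exact: (continuous_comp cg cs).
  exact: (continuousM ch ch).
have iH : (lebesgue_rV R n.+1).-integrable setT
    (EFin \o (fun x => h (gradient phi x) ^+ 2)).
  apply: (rV_integrable (M := M)) => // x /box0/gradient_eq0 ->.
  by rewrite support0// expr0n.
have iGj j : (lebesgue_rV R n.+1).-integrable setT (EFin \o G j).
  apply: (rV_integrable (M := M)) => // x /box0/tsupport_eq0.
  by rewrite /G => ->; rewrite mulr0 mul0r expr0n mul0r addr0.
rewrite (integral_eq0_off (D := Om°) (f := fun x => phi x ^+ 2)); last first.
  by move=> x Ox; rewrite tsupport_eq0 ?expr0n// => /SO.
rewrite (integral_eq0_off (D := Om°) (f := fun x => h (gradient phi x) ^+ 2));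
    last first.
  by move=> x Ox; rewrite gradient_eq0 ?support0 ?expr0n// => /SO; exact: Ox.
have iGs : (lebesgue_rV R n.+1).-integrable setT
    (fun x => (\sum_(j < n.+1) (G j x)%:E)%E).
  by apply: integrable_sum => // j _; exact: iGj.
rewrite -integralZl//; last first.
  apply: (rV_integrable (M := M)) => [x|x /box0/tsupport_eq0 ->].
    exact: (continuousM (cphi x) (cphi x)).
  by rewrite expr0n.
(* The terms [G j] have zero integral, so adding them changes nothing and reduces the claim to the
   pointwise inequality. *)
have -> : (\int[lebesgue_rV R n.+1]_x ((alpha ^+ 2)%:E * (phi x ^+ 2)%:E) =
    \int[lebesgue_rV R n.+1]_x ((A x)%:E + \sum_(j < n.+1) (G j x)%:E))%E.
  rewrite integralD// integral_sum//.
  by rewrite [X in (_ + X)%E]big1 ?adde0// => j _; exact: iG.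
apply: le_integral => //; first exact: integrableD.
move=> x _; rewrite sumEFin -EFinD lee_fin.
have [Sx|Sx] := pselect (tsupport phi x); last first.
  rewrite /A tsupport_eq0// expr0n mulr0 add0r big1 ?sqr_ge0// => j _.
  by rewrite /G tsupport_eq0// mulr0 mul0r expr0n mul0r addr0.
have [s0 c0 sc] := trig x Sx.
have := hersch_pointwise (h := h) (g := gradient phi x) m0 eps0 (phi x)
  ae1 ae (fun i => support_norm convK symK _ (Ke i)) s0 c0 al0 sc.
apply: le_trans; rewrite lerD2l big_split/= -!mulr_sumr.
rewrite lerD2r le_eqVlt; apply/orP; left; apply/eqP; congr (_ * _).
by apply: eq_bigr => j _; rewrite /gradient [X in _ = X * _]mxE.
Qed.

End hersch_inequality.

(** * Passage from test functions to the Sobolev space *)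

Lemma ge0_integral_le_lin d (T : measurableType d) (R : realType)
    (mu : {measure set T -> \bar R}) (D : set T) (f g1 g2 : T -> R) (c1 c2 : R) :
  measurable D -> measurable_fun D f ->
  measurable_fun D g1 -> measurable_fun D g2 ->
  (forall x, 0 <= f x) -> (forall x, 0 <= g1 x) -> (forall x, 0 <= g2 x) ->
  0 <= c1 -> 0 <= c2 -> (forall x, D x -> f x <= c1 * g1 x + c2 * g2 x) ->
  (\int[mu]_(x in D) (f x)%:E <= c1%:E * \int[mu]_(x in D) (g1 x)%:E +
     c2%:E * \int[mu]_(x in D) (g2 x)%:E)%E.
Proof.
move=> mD mf mg1 mg2 f0 g10 g20 c10 c20 fg.
have mE (k : T -> R) : measurable_fun D k -> measurable_fun D (EFin \o k).
  by move=> mk; exact/measurable_EFinP.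
have mZ (c : R) (k : T -> R) : measurable_fun D k ->
    measurable_fun D (fun x => c%:E * (k x)%:E)%E.
  move=> mk; apply: (mE (fun x => c * k x)).
  exact: measurable_funM (measurable_cst _) mk.
rewrite -!ge0_integralZl_EFin//; try by [exact: mE|move=> x _; rewrite lee_fin].
rewrite -ge0_integralD//; try by [exact: mZ|move=> x _; rewrite mule_ge0 ?lee_fin].
apply: ge0_le_integral => //.
- by move=> x _; rewrite lee_fin.
- exact: mE.
- by apply: emeasurable_funD; exact: mZ.
Qed.

Section sobolev_limit.
Context (R : realType) (n : nat).
Local Notation mu := (lebesgue_rV R n).

Lemma rV_measurable_funP (D : set 'rV[R]_n) (g : 'rV[R]_n -> 'rV[R]_n)
    (F : 'rV[R]_n -> R) :
  measurable D -> (forall i, measurable_fun D (fun x => g x ord0 i)) ->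
  continuous F -> measurable_fun D (fun x => F (g x)).
Proof.
move=> mD mg cF.
(* The coordinates of [g] are measurable only on [D]; extended by 0 they form a measurable map on
   the whole space. *)
pose g' x : 'rV[R]_n := \row_i ((fun y => g y ord0 i) \_ D) x.
have mg' : measurable_fun setT g'.
  apply: measurable_fun_rowP => i.
  rewrite (_ : (fun x => _) = (fun y => g y ord0 i) \_ D).
    by apply/(measurable_restrictT _ mD); exact: mg.
  by apply/funext => x; rewrite mxE.
have : measurable_fun D (F \o g').
  apply: measurable_funS measurableT _ _ => //.
  exact: measurableT_comp (rV_continuous_measurable cF) mg'.
apply: eq_measurable_fun => x xD /=; congr F.
by apply/rowP => i; rewrite mxE patchE xD.
Qed.

Lemma continuous_measurableW (D : set 'rV[R]_n) (f : 'rV[R]_n -> R) :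
  measurable D -> continuous f -> measurable_fun D f.
Proof.
by move=> mD cf; exact: measurable_funS measurableT _ (rV_continuous_measurable cf).
Qed.

(** Young's inequality: the difference of the two sides is a square divided by [eta]. *)
Lemma sqr_add_le (x y eta : R) : 0 < eta ->
  (x + y) ^+ 2 <= (1 + eta) * x ^+ 2 + (1 + eta^-1) * y ^+ 2.
Proof.
move=> eta0; rewrite -subr_ge0.
rewrite (_ : _ - _ = eta^-1 * (eta * x - y) ^+ 2).
  by rewrite mulr_ge0 ?sqr_ge0// invr_ge0 ltW.
by field; exact: lt0r_neq0.
Qed.

Lemma lee_cvg0 (x y : \bar R) (c : R) (J : nat -> \bar R) : 0 < c ->
  J @ \oo --> 0%E -> (forall k, x <= y + c%:E * J k)%E -> (x <= y)%E.
Proof.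
move=> c0 J0 xy; apply/lee_addgt0Pr => e e0.
have H : nbhs (0%E : \bar R) [set z | (z < (e / c)%:E)%E].
  apply: open_nbhs_nbhs; split; first exact: open_ereal_lt_ereal.
  by rewrite /= lte_fin divr_gt0.
have [k _ /(_ k (leqnn k)) Jk] := J0 _ H.
apply: (le_trans (xy k)); rewrite leeD2l//.
apply: (@le_trans _ _ (c%:E * (e / c)%:E)%E).
  by rewrite lee_pmul2l// ltW.
by rewrite -EFinM mulrC divfK// gt_eqF.
Qed.

End sobolev_limit.

Section hersch_sobolev.
Context (R : realType) (n : nat) (K Om : set 'rV[R]_n.+1).
Hypotheses (convK : convex_body K) (symK : origin_symmetric K).
Hypothesis convOm : convex_body Om.
Local Notation h := (support_fun K).
Local Notation mu := (lebesgue_rV R n.+1).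
Local Notation D := (Om°).

(** [I] and [H] stand for the integrals of [u^2] and [h(g)^2], [P] and [Q] for those of an
    approximating test function, [J] for its squared Sobolev distance to [u]. The [+ 1] makes the
    coefficient of [J] positive, as [lee_cvg0] requires. *)
Lemma lee_chain (I P Q H J : \bar R) (A a1 a2 a3 : R) :
  (0 <= P)%E -> (0 <= J)%E -> (0 <= H)%E -> 0 <= A -> 0 <= a1 -> 0 <= a2 -> 0 <= a3 ->
  (I <= a1%:E * P + a2%:E * J)%E -> (A%:E * P <= Q)%E ->
  (Q <= a1%:E * H + a3%:E * J)%E ->
  (A%:E * I <= (a1 ^+ 2)%:E * H + (a1 * a3 + A * a2 + 1)%:E * J)%E.
Proof.
move=> P0 J0 H0 A0 a10 a20 a30 IPJ APQ QHJ.
have e0 (a : R) (x : \bar R) : 0 <= a -> (0 <= x)%E -> (0 <= a%:E * x)%E.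
  by move=> a0 x0; rewrite mule_ge0.
apply: (le_trans (lee_wpmul2l _ IPJ)) => //.
rewrite ge0_muleDr ?e0// muleCA.
apply: (@le_trans _ _ (a1%:E * (a1%:E * H + a3%:E * J) + A%:E * (a2%:E * J)))%E.
  apply: leeD => //; apply: lee_wpmul2l => //; exact: le_trans QHJ.
rewrite ge0_muleDr ?e0// !muleA -!EFinM -addeA -expr2 leeD2l//.
rewrite -ge0_muleDl ?lee_fin ?mulr_ge0// -EFinD.
by apply: lee_wpmul2r => //; rewrite lee_fin lerDl.
Qed.

Lemma support_sqr_le (C : R) (v : 'rV[R]_n.+1) : 0 <= C -> h v <= C * `|v| ->
  h v ^+ 2 <= C ^+ 2 * dotr v v.
Proof.
move=> C0 hC; have h0 := support_ge0 convK symK v.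
apply: (@le_trans _ _ ((C * `|v|) ^+ 2)).
  by rewrite ler_pXn2r ?nnegrE ?mulr_ge0.
by rewrite exprMn ler_wpM2l ?sqr_ge0// sqr_norm_le_dotrr.
Qed.

(** Young's inequality is used twice, to pass from [u] to a test function and from its gradient back
    to [g]. Each use costs a factor [1 + eta] and a multiple of the Sobolev distance, which tends to
    0. *)
Lemma hersch_W012 u g (rho eta : R) : W012 D u g ->
  aniso_inradius K Om < rho -> 0 < eta ->
  (((pi / (2 * rho)) ^+ 2)%:E * \int[mu]_(x in D) (u x ^+ 2)%:E <=
   ((1 + eta) ^+ 2)%:E * \int[mu]_(x in D) (h (g x) ^+ 2)%:E)%E.
Proof.
move=> [[[mu_ _] gL2 _] [phi [tphi J0]]] Rrho eta0.
have mD : measurable D by apply: rV_open_measurable; exact: open_interior.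
set A := (pi / (2 * rho)) ^+ 2.
have A0 : 0 <= A by exact: sqr_ge0.
have [C C0 hC] := support_le_norm convK.
have ch := support_continuous convK.
have mg i : measurable_fun D (fun x => g x ord0 i) by have [] := gL2 i.
have ei0 : 0 < eta^-1 by rewrite invr_gt0.
pose c := (1 + eta) * ((1 + eta^-1) * C ^+ 2) + A * (1 + eta^-1) + 1.
have c0 : 0 < c.
  rewrite /c ltr_wpDl// addr_ge0// mulr_ge0//; try lra.
  by rewrite mulr_ge0 ?sqr_ge0//; lra.
apply: (lee_cvg0 c0 J0) => k.
set phik := phi k; have tk : test_function D phik := tphi k.
pose v x := gradient phik x - g x.
pose J x := (phik x - u x) ^+ 2 + dotr (v x) (v x).
change (W12_sqdist D phik (gradient phik) u g) with
  (\int[mu]_(x in D) (J x)%:E)%E.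
have J_ge0 x : 0 <= J x by rewrite addr_ge0 ?sqr_ge0// dotrr_ge0.
have mphi : measurable_fun D phik.
  exact: (continuous_measurableW mD (test_function_continuous tk)).
have mp i : measurable_fun D (partial i phik).
  by apply: continuous_measurableW mD _; exact: partial_continuous tk _.
have mJ : measurable_fun D J.
  apply: measurable_funD; first by apply: measurable_funX; exact: measurable_funB.
  apply: measurable_sum => i; rewrite (_ : (fun x => _) =
      fun x => (partial i phik x - g x ord0 i) * (partial i phik x - g x ord0 i)).
    have mv := measurable_funB (mp i) (mg i).
    exact: (measurable_funM mv mv).
  by apply/funext => x; rewrite !mxE.
have mhg : measurable_fun D (fun x => h (g x) ^+ 2).
  by apply: measurable_funX; exact: rV_measurable_funP.
have mhp : measurable_fun D (fun x => h (gradient phik x) ^+ 2).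
  apply: measurable_funX; apply: rV_measurable_funP => // i.
  rewrite (_ : (fun x => _) = partial i phik); first exact: mp.
  by apply/funext => x; rewrite mxE.
have iJ0 : (0 <= \int[mu]_(x in D) (J x)%:E)%E.
  by apply: integral_ge0 => x _; rewrite lee_fin.
apply: (@lee_chain _ (\int[mu]_(x in D) (phik x ^+ 2)%:E)
  (\int[mu]_(x in D) (h (gradient phik x) ^+ 2)%:E)) => //.
- by apply: integral_ge0 => x _; rewrite lee_fin sqr_ge0.
- by apply: integral_ge0 => x _; rewrite lee_fin sqr_ge0.
- by lra.
- by lra.
- by rewrite mulr_ge0 ?sqr_ge0//; lra.
- apply: ge0_integral_le_lin => //; try by [exact: measurable_funX|
    move=> x; rewrite sqr_ge0|lra].
  move=> x _; rewrite -{1}(subrK (phik x) (u x)) addrC.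
  apply: (le_trans (sqr_add_le _ _ eta0)).
  rewrite lerD2l ler_wpM2l//; first by lra.
  by rewrite -sqrrN opprB lerDl dotrr_ge0.
- exact: (hersch_test_function convK symK convOm tk Rrho).
- apply: ge0_integral_le_lin => //; try by [move=> x; rewrite sqr_ge0|lra].
    by rewrite mulr_ge0 ?sqr_ge0//; lra.
  move=> x _.
  have hvg : h (gradient phik x) <= h (g x) + h (v x).
    by have := supportD convK (g x) (v x); rewrite /v addrC subrK addrC.
  apply: (@le_trans _ _ ((h (g x) + h (v x)) ^+ 2)).
    by rewrite ler_pXn2r ?nnegrE ?addr_ge0 ?support_ge0.
  apply: (le_trans (sqr_add_le _ _ eta0)); rewrite lerD2l -mulrA ler_wpM2l//.
    by lra.
  apply: (le_trans (support_sqr_le C0 (hC (v x)))).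
  by rewrite ler_wpM2l ?sqr_ge0// lerDr sqr_ge0.
Qed.

End hersch_sobolev.

(** The fourth power collects [(1 + eta)^2] from the Sobolev approximation and [(1 + eta)^2] from
    taking [rho] equal to [1 + eta] times the inradius. *)
Lemma ler_mul_exp4 (R : realType) (x y : R) : 0 <= y ->
  (forall eta, 0 < eta -> x <= (1 + eta) ^+ 4 * y) -> x <= y.
Proof.
move=> y0 xy; apply/ler_addgt0Pl => e e0.
(* For [eta <= 1] the binomial expansion gives [(1 + eta)^4 <= 1 + 15 eta], as [4 + 6 + 4 + 1 = 15];
   the [+ 1] keeps the denominator positive. *)
pose eta := Num.min 1 (e / (15 * y + 1)).
have d0 : 0 < 15 * y + 1 by lra.
have eta0 : 0 < eta by rewrite lt_min ltr01 divr_gt0.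
have eta1 : eta <= 1 by rewrite ge_min lexx.
have etay : eta * (15 * y) <= e.
  apply: (@le_trans _ _ (eta * (15 * y + 1))).
    by rewrite ler_wpM2l ?(ltW eta0)// lerDl.
  by rewrite -ler_pdivlMr// ge_min lexx orbT.
apply: (le_trans (xy eta eta0)).
have eta4 : (1 + eta) ^+ 4 <= 1 + 15 * eta.
  have e2 : eta ^+ 2 <= eta by rewrite expr2 ler_piMl ?(ltW eta0).
  have e3 : eta ^+ 3 <= eta.
    by rewrite exprS (le_trans _ e2)// expr2 ler_wpM2l ?(ltW eta0)// -expr2.
  have e4 : eta ^+ 4 <= eta.
    by rewrite exprS (le_trans _ e2)// expr2 ler_wpM2l ?(ltW eta0).
  by lra.
have := ler_wpM2r y0 eta4; lra.
Qed.

(** * The lower bound for the Rayleigh quotient *)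

Section hersch_quotient.
Context (R : realType) (n : nat) (K Om : set 'rV[R]_n.+1).
Hypotheses (convK : convex_body K) (symK : origin_symmetric K).
Hypothesis convOm : convex_body Om.
Local Notation h := (support_fun K).
Local Notation mu := (lebesgue_rV R n.+1).
Local Notation D := (Om°).

(** A nonnegative function with zero integral vanishes almost everywhere. This makes the denominator
    of the quotient positive. *)
Lemma integral_sqr_gt0 (u : 'rV[R]_n.+1 -> R) : in_L2 D u ->
  ~ {ae mu, forall x, D x -> u x = 0} ->
  (0 < \int[mu]_(x in D) (u x ^+ 2)%:E)%E.
Proof.
move=> [mu_ _] nae; have mD : measurable D.
  by apply: rV_open_measurable; exact: open_interior.
rewrite lt_neqAle integral_ge0 ?andbT => [|x _]; last by rewrite lee_fin sqr_ge0.
apply/eqP => I0; apply: nae.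
have mu2 : measurable_fun D (fun x => (u x ^+ 2)%:E).
  by apply/measurable_EFinP; exact: measurable_funX.
have : (\int[mu]_(x in D) `|(u x ^+ 2)%:E| = 0)%E.
  by rewrite I0; apply: eq_integral => x _; rewrite gee0_abs// lee_fin sqr_ge0.
move=> /(ae_eq_integral_abs mu mD mu2); apply: filterS => x xu Dx.
by have /eqP := xu Dx; rewrite eqe sqrf_eq0 => /eqP.
Qed.

(** The quotient uses real-valued integrals, which send an infinite value to 0, so the numerator
    must be shown finite. It is dominated by the squared coordinates of [g]. *)
Lemma support_gradient_L2 (g : 'rV[R]_n.+1 -> 'rV[R]_n.+1) :
  (forall i, in_L2 D (fun x => g x ord0 i)) ->
  (\int[mu]_(x in D) (h (g x) ^+ 2)%:E < +oo)%E.
Proof.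
move=> gL2; have mD : measurable D.
  by apply: rV_open_measurable; exact: open_interior.
have [C C0 hC] := support_le_norm convK.
have ch := support_continuous convK.
have mg i : measurable_fun D (fun x => g x ord0 i) by have [] := gL2 i.
have mgi i : measurable_fun D (fun x => (g x ord0 i ^+ 2)%:E).
  by apply/measurable_EFinP; exact: measurable_funX.
apply: (@le_lt_trans _ _ ((C ^+ 2)%:E *
    \sum_(i < n.+1) \int[mu]_(x in D) (g x ord0 i ^+ 2)%:E)%E).
  rewrite -ge0_integral_sum//; last by move=> i x _; rewrite lee_fin sqr_ge0.
  rewrite -ge0_integralZl_EFin ?sqr_ge0//.
  - apply: ge0_le_integral => //.
    + by move=> x _; rewrite lee_fin sqr_ge0.
    + apply/measurable_EFinP; apply: measurable_funX.
      exact: rV_measurable_funP.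
    + by apply: measurable_funeM; exact: emeasurable_sum.
    + move=> x _; rewrite sumEFin -EFinM lee_fin.
      exact: (support_sqr_le convK symK C0 (hC (g x))).
  - by move=> x _; rewrite sume_ge0// => i _; rewrite lee_fin sqr_ge0.
  - exact: emeasurable_sum.
rewrite lte_mul_pinfty ?lee_fin ?sqr_ge0//.
by apply: lte_sum_pinfty => i _; have [_] := gL2 i.
Qed.

Lemma hersch_quotient u g : W012 D u g ->
  ~ {ae mu, forall x, D x -> u x = 0} ->
  pi ^+ 2 / 4 * aniso_inradius K Om ^- 2 <=
  (\int[mu]_(x in D) (h (g x)) ^+ 2) / (\int[mu]_(x in D) (u x) ^+ 2).
Proof.
move=> W nae; have [[uL2 gL2 _] _] := W.
have R0 := aniso_inradius_ge0 convK symK convOm.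
have U0 := integral_sqr_gt0 uL2 nae.
have Hoo := support_gradient_L2 gL2.
have H0 : (0 <= \int[mu]_(x in D) (h (g x) ^+ 2)%:E)%E.
  by apply: integral_ge0 => x _; rewrite lee_fin sqr_ge0.
have Uf : (\int[mu]_(x in D) (u x ^+ 2)%:E)%E \is a fin_num.
  by rewrite ge0_fin_numE ?(ltW U0)//; case: uL2.
have Hf : (\int[mu]_(x in D) (h (g x) ^+ 2)%:E)%E \is a fin_num.
  by rewrite ge0_fin_numE.
have ineq (rho eta : R) : aniso_inradius K Om < rho -> 0 < eta ->
    (pi / (2 * rho)) ^+ 2 * (\int[mu]_(x in D) (u x) ^+ 2) <=
    (1 + eta) ^+ 2 * (\int[mu]_(x in D) (h (g x)) ^+ 2).
  move=> Rrho eta0; rewrite -lee_fin !EFinM /Rintegral !fineK//.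
  exact: (hersch_W012 convK symK convOm W Rrho eta0).
have u0 : 0 < \int[mu]_(x in D) (u x) ^+ 2.
  by rewrite -lte_fin /Rintegral fineK.
have h0 : 0 <= \int[mu]_(x in D) (h (g x)) ^+ 2.
  by rewrite -lee_fin /Rintegral fineK.
have q0 := divr_ge0 h0 (ltW u0).
(* With the convention that the inverse of 0 is 0, the left side is 0 in this case. *)
have [->|RN0] := eqVneq (aniso_inradius K Om) 0.
  by rewrite expr0n invr0 mulr0.
have Rp : 0 < aniso_inradius K Om by rewrite lt_neqAle eq_sym RN0.
apply: ler_mul_exp4 => // eta eta0.
have t0 : 0 < 1 + eta by lra.
have Rt : aniso_inradius K Om < (1 + eta) * aniso_inradius K Om.
  by rewrite ltr_pMl// ltrDl.
rewrite mulrA ler_pdivlMr//.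
have := ineq _ eta Rt eta0.
(* Here [rho] is [1 + eta] times the inradius; multiplying by [(1 + eta)^2] removes that factor on
   the left and produces the fourth power on the right. *)
rewrite -(ler_pM2l (exprn_gt0 2 t0)); congr (_ <= _); last by ring.
rewrite mulrA; congr (_ * _); field.
by rewrite RN0 gt_eqF.
Qed.

End hersch_quotient.

Theorem theorem5p5 (R : realType) (n : nat) (K Om : set 'rV[R]_n.+1)
    (convK : convex_body K) (regK : C2plus_regular K)
    (symK : origin_symmetric K) (convOm : convex_body Om) :
  ((pi ^+ 2 / 4 * aniso_inradius K Om ^- 2)%:E <= principal_frequency K Om)%E.
Proof.
apply/ereal_infP => _ [u [g [W nae ->]]]; rewrite lee_fin.
exact: hersch_quotient.
Qed.
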